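(* For each integer $m\ge 2$ we have $$\operatorname{mon}\mathcal{P}({}^m\ell_\infty)=\ell_{\frac{2m}{m-1},\infty}.$$ Moreover, there exists a constant $C>0$ (independent of $m$, $z$ and $P$) such that for every integer $m\ge 2$, every $z\in \ell_{\frac{2m}{m-1},\infty}$ and every $P\in\mathcal{P}({}^m\ell_\infty)$, $$\sum_{|\alpha|=m}|c_\alpha(P)z^\alpha|\le C^m\,\|z\|^m\,\|P\|,$$ where $\|z\|=\sup_n z_n^*\,n^{\frac{m-1}{2m}}$ is the norm in $\ell_{\frac{2m}{m-1},\infty}$.
   Context: All sequences are complex. $\ell_\infty$ is the space of bounded sequences with the sup norm, and $\mathbb{D}^\infty$ denotes its open unit ball. $\mathcal{P}({}^m\ell_\infty)$ is the Banach space of bounded $m$-homogeneous polynomials $P:\ell_\infty\to\mathbb{C}$ (restrictions to the diagonal of bounded $m$-linear forms), with $\|P\|=\sup_{z\in\mathbb{D}^\infty}|P(z)|$. $\mathbb{N}_0^{(\mathbb{N})}$ is the set of finitely supported sequences $\alpha$ of non-negative integers (with $\mathbb{N}_0^k$ identified with the sequences supported in the first $k$ coordinates); $|\alpha|=\sum_j\alpha_j$ and $z^\alpha=\prod_j z_j^{\alpha_j}$. The monomial coefficients $c_\alpha(P)$, $\alpha\in\mathbb{N}_0^{(\mathbb{N})}$, are the unique complex numbers such that for every $k$ and every $z\in\mathbb{C}^k$ (identified with $\mathbb{C}^k\times\{0\}$), $P(z)=\sum_{\alpha\in\mathbb{N}_0^k}c_\alpha(P)z^\alpha$. The set of monomial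 convergence is $$\operatorname{mon}\mathcal{P}({}^m\ell_\infty)=\Big\{z\in\ell_\infty : \forall P\in\mathcal{P}({}^m\ell_\infty),\ P(z)=\sum_{\alpha\in\mathbb{N}_0^{(\mathbb{N})}}c_\alpha(P)z^\alpha\Big\},$$ where the equality means that the series converges absolutely (as a net) and its sum is $P(z)$. For $z\in\ell_\infty$ the decreasing rearrangement is $z_n^*=\inf\{\sup_{j\in\mathbb{N}\setminus J}|z_j| : J\subseteq\mathbb{N},\ \operatorname{card}(J)<n\}$. For $1\le q<\infty$, $\ell_{q,\infty}$ is the space of $z\in\ell_\infty$ with $\|z\|=\sup_n z_n^*n^{1/q}<\infty$. *)

(* Defs.v *)
From HB Require Import structures.
From mathcomp Require Import all_boot all_order all_algebra finmap complex.
From mathcomp Require Import all_classical all_reals all_analysis.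
From mathcomp.analysis.showcase Require summability.

Set Implicit Arguments.
Unset Strict Implicit.
Unset Printing Implicit Defensive.

Import Order.TTheory GRing.Theory Num.Theory.
Import ComplexField.Normc.
Import numFieldNormedType.Exports.

Local Open Scope classical_set_scope.
Local Open Scope ring_scope.

(* Moduli of complex numbers are taken with [normc : R[i] -> R], since the
   norm [`|z|] of [R[i]] takes its values in [R[i]]. *)

Section linfty.
Variable R : realType.

Definition bounded_seq : {pred nat -> R[i]} :=
  fun z => `[< exists M : R, forall n, normc (z n) <= M >].

Fact bounded_seq_submod_closed : submod_closed bounded_seq.
Proof.
split; first by apply/asboolP; exists 0 => n; rewrite normc0.
move=> a u v /asboolP[M uM] /asboolP[N vN]; apply/asboolP.
exists (normc a * M + N) => n.
apply: (le_trans (le_normcD _ _)); apply: lerD; last exact: vN.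
rewrite [X in normc X](_ : _ = a * u n) // normcM ler_wpM2l //.
by case: a => x y; exact: sqrtr_ge0.
Qed.

HB.instance Definition _ :=
  GRing.isSubmodClosed.Build R[i] (nat -> R[i]) bounded_seq
    bounded_seq_submod_closed.

Record linfty := Linfty {
  linfty_seq :> nat -> R[i];
  _ : linfty_seq \in bounded_seq }.

HB.instance Definition _ := [isSub for linfty_seq].
HB.instance Definition _ := [Choice of linfty by <:].
HB.instance Definition _ := [SubChoice_isSubLmodule of linfty by <:].

Definition linfty_norm (z : linfty) : R := sup (range (fun n => normc (z n))).

End linfty.

Section polynomials.
Variables (R : realType) (m : nat).

Definition multilinear (L : ('I_m -> linfty R) -> R[i]) : Prop :=
  forall (i : 'I_m) (x : 'I_m -> linfty R),
    scalar (fun u : linfty R => L [eta x with i |-> u]).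

Definition bounded_form (L : ('I_m -> linfty R) -> R[i]) : Prop :=
  exists K : R, forall x, normc (L x) <= K * \prod_(i < m) linfty_norm (x i).

Definition hpoly : set (linfty R -> R[i]) :=
  [set P | exists L : ('I_m -> linfty R) -> R[i],
     [/\ multilinear L, bounded_form L & P = fun z => L (fun=> z)]].

End polynomials.

Definition poly_norm (R : realType) (P : linfty R -> R[i]) : R :=
  sup [set normc (P z) | z in [set z | linfty_norm z < 1]].

Definition multiindex := {fsfun nat -> nat with 0%N}.

Definition multideg (a : multiindex) : nat := (\sum_(j <- finsupp a) a j)%N.

Definition monomial (R : realType) (z : nat -> R[i]) (a : multiindex) : R[i] :=
  \prod_(j <- finsupp a) z j ^+ a j.

(* The family [f] indexed by [A] is absolutely summable, and its finite partial
   sums converge to [s] along the finite subsets of [A] ordered by inclusion. *)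
Definition abs_sums_to (R : realType) (I : choiceType) (A : set I)
    (f : I -> R[i]) (s : R[i]) : Prop :=
  (\esum_(i in A) (normc (f i))%:E < +oo)%E /\
  (fun F : {fset I} => normc (\sum_(i <- F | i \in A) f i - s))
    @ summability.totally --> (0 : R).

(* Coordinates are numbered from 0: C^k and N_0^k consist of the sequences
   vanishing at every index [j >= k]. *)
Definition supported_below (T : Type) (zero : T) (k : nat) (x : nat -> T) :=
  forall j, (k <= j)%N -> x j = zero.

Definition is_monomial_coefs (R : realType) (P : linfty R -> R[i])
    (c : multiindex -> R[i]) : Prop :=
  forall (k : nat) (z : linfty R), supported_below 0 k z ->
    abs_sums_to [set a : multiindex | supported_below 0%N k a]
      (fun a => c a * monomial z a) (P z).

(* For [P] in some [hpoly R m] exactly one family satisfies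
   [is_monomial_coefs P]; the default value of [xget] is then irrelevant. *)
Definition monomial_coef (R : realType) (P : linfty R -> R[i]) :
    multiindex -> R[i] :=
  xget (fun=> 0) [set c | is_monomial_coefs P c].

Definition mon (R : realType) (m : nat) : set (linfty R) :=
  [set z : linfty R | forall P : linfty R -> R[i], hpoly m P ->
     abs_sums_to setT (fun a => monomial_coef P a * monomial z a) (P z)].

(* z_n^*, meaningful for n >= 1. *)
Definition decr_rearr (R : realType) (z : nat -> R[i]) (n : nat) : R :=
  inf [set sup [set normc (z j) | j in ~` [set` J]]
      | J in [set J : {fset nat} | (#|` J| < n)%N]].

Definition weak_norm (R : realType) (q : R) (z : nat -> R[i]) : \bar R :=
  ereal_sup [set (decr_rearr z n * n%:R `^ q^-1)%:E | n in [set n | (0 < n)%N]].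

Definition weak_lq (R : realType) (q : R) : set (linfty R) :=
  [set z : linfty R | (weak_norm q z < +oo)%E].

(* Main.v *)
Require Import Defs.
From mathcomp Require Import all_boot all_order all_algebra finmap complex.
From mathcomp Require Import all_classical all_reals all_analysis.
From mathcomp Require Import separable cyclic cyclotomic ring lra zify.

(* Upper estimate.  Let [p = \sum_a c_a w^a] be [m]-homogeneous in [n] variables,
   [|z_1| >= |z_2| >= ...], and split the multi-indices according to their last
   variable [k].  On the torus the functions [E_k = w_k dp/dw_k], whose
   coefficients are [a_k c_a], satisfy [\sum_k |E_k (w)| <= sup_{|v_i| <= 2} |p (v)|]
   (Cauchy's estimate for [t |-> p (w (1 + t u))]), and the [L^1] and [L^2] norms
   of homogeneous polynomials of degree [m] are equivalent up to [2^m].  Hence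
   [\sum_k (\sum_a |a_k c_a|^2)^(1/2)] is controlled by the norm of [p].  By
   Cauchy-Schwarz it remains to bound [\sum_a |z^a|^2] over the [a] with last
   variable [k] by [C^m], which follows from [|z_i|^2 <= i^(-(m-1)/m)].  Integrals
   over the torus are averages over [N]-th roots of unity with [N > 2m].

   Lower estimate.  If the weak norm of [z] is infinite, there are disjoint blocks
   of [m n_k] coordinates on which [z] is large.  On each block the [m]-linear form
   [\sum x_1(i_1) w^(i_1 i_2) x_2(i_2) ... w^(i_(m-1) i_m) x_m(i_m)], with [w] a
   primitive [n_k]-th root of unity, has norm at most [n_k^((m+1)/2)] and [n_k^m]
   unimodular coefficients; a weighted sum of these forms is a polynomial whose
   monomial series does not converge absolutely at [z]. *)

Set Implicit Arguments.
Unset Strict Implicit.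
Unset Printing Implicit Defensive.

Import Order.TTheory GRing.Theory Num.Theory.
Import ComplexField.Normc.
Import numFieldNormedType.Exports.

Local Open Scope classical_set_scope.
Local Open Scope ring_scope.

Local Notation "x %:C" := (real_complex _ x) : ring_scope.

(** * Characters of the discrete torus *)

Section modulus.
Variable R : realType.
Implicit Types (x y z : R[i]).

(** The exponent [2m/(m-1)] is the one at which both estimates balance. Above:
    [\sum_(i <= k) i^(-(m-1)/m)] is of order [m k^(1/m)], so the [m - 1] factors other than the last
    contribute about [k^((m-1)/m)], exactly what [|z_k|^2 <= k^(-(m-1)/m)] compensates; hence a
    bound uniform in [k]. Below: if [|z|] is about [T n^(-(m-1)/(2m))] on a block, its [n^m]
    monomials, divided by the norm bound [n^((m+1)/2)], add up to [T^m] whatever [n] is. Two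
    obstacles lie outside the estimates. The coefficients are only characterized by expansions at
    finitely supported points, possibly with infinitely many terms, so their uniqueness has to be
    proved; averaging over discrete tori does it. And a bound on the series does not give its value
    at [z]: for that, [z] must be a norm limit of its truncations, which holds because the weak
    space lies in [c_0]. *)

Lemma normc_ge0 z : 0 <= normc z.
Proof. by case: z => x y; exact: sqrtr_ge0. Qed.

Lemma normc_sum (I : Type) (r : seq I) (P : pred I) (F : I -> R[i]) :
  normc (\sum_(i <- r | P i) F i) <= \sum_(i <- r | P i) normc (F i).
Proof.
elim/big_ind2: _ => //; first by rewrite normc0.
by move=> x u y v xu yv; apply: (le_trans (le_normcD _ _)); rewrite lerD.
Qed.

Lemma normc_prod (I : Type) (r : seq I) (P : pred I) (F : I -> R[i]) :
  normc (\prod_(i <- r | P i) F i) = \prod_(i <- r | P i) normc (F i).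
Proof. by apply: big_morph => [x y|]; [exact: normcM|exact: normc1]. Qed.

Lemma normcX z n : normc (z ^+ n) = normc z ^+ n.
Proof. by elim: n => [|n IH]; rewrite ?normc1// !exprS normcM IH. Qed.

Lemma normc_real (x : R) : normc x%:C = `|x|.
Proof. by rewrite /normc /= expr0n /= addr0 sqrtr_sqr. Qed.

Lemma normc_nat n : normc (n%:R : R[i]) = n%:R.
Proof. by rewrite -(rmorph_nat (real_complex R)) normc_real ger0_norm. Qed.

Lemma normc_eq0 z : (normc z == 0) = (z == 0).
Proof. by apply/eqP/eqP => [/eq0_normc//|->]; exact: normc0. Qed.

Lemma normc_sqr z : (normc z ^+ 2)%:C = z * z^*%C.
Proof. by rewrite -sqr_normc normc_def rmorphXn; case: z. Qed.

Lemma conjc_unit z : normc z = 1 -> z^*%C = z^-1.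
Proof.
move=> z1; have z0 : z != 0 by rewrite -normc_eq0 z1 oner_eq0.
by apply: (mulfI z0); rewrite -normc_sqr z1 expr1n divff.
Qed.

Lemma normc_unity N z : (0 < N)%N -> z ^+ N = 1 -> normc z = 1.
Proof.
move=> N0 zN; apply/eqP; rewrite -(pexpr_eq1 N0) ?normc_ge0//.
by rewrite -normcX zN normc1.
Qed.

Lemma prim_root_exists N : (0 < N)%N -> exists w : R[i], N.-primitive_root w.
Proof.
move=> N_gt0; pose p : {poly R[i]} := 'X^N - 1; have [r Dp] := closed_field_poly_normal p.
move: Dp; rewrite lead_coefXnsubC// scale1r => Dp.
have rn1 : all N.-unity_root r by apply/allP=> z; rewrite -root_prod_XsubC -Dp.
have sz_r : (N < (size r).+1)%N.
  by rewrite -(size_prod_XsubC r id) -Dp size_XnsubC.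
have [|z] := hasP (has_prim_root N_gt0 rn1 _ sz_r); last by exists z.
by rewrite -separable_prod_XsubC -Dp separable_Xn_sub_1 // pnatr_eq0 -lt0n.
Qed.

End modulus.

Definition exps n N (a : {ffun 'I_n -> 'I_N}) (i : 'I_n) : nat := a i.

Section torus.
Variables (R : realType) (N : nat) (w : R[i]) (n : nat).
Hypotheses (N_gt0 : (0 < N)%N) (wP : N.-primitive_root w).

(** Exponents are arbitrary naturals: bounded ones come through [exps], while the uniqueness of
    coefficients pairs characters of unbounded degree. *)
Definition character (a : 'I_n -> nat) (t : 'I_n -> 'I_N) : R[i] :=
  \prod_i (w ^+ t i) ^+ a i.

Let w1 : normc w = 1.
Proof. exact: normc_unity N_gt0 (prim_expr_order wP). Qed.

Let w_neq0 : w != 0.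
Proof. by rewrite -normc_eq0 w1 oner_eq0. Qed.

Lemma normc_character a t : normc (character a t) = 1.
Proof.
by rewrite /character normc_prod big1// => i _; rewrite !normcX w1 !expr1n.
Qed.

Lemma sum_unity_root (a b : nat) :
  \sum_(t < N) (w ^+ t) ^+ a / (w ^+ t) ^+ b =
  if a == b %[mod N] then N%:R else 0 :> R[i].
Proof.
rewrite (eq_bigr (fun t : 'I_N => (w ^+ a / w ^+ b) ^+ t)); last first.
  by move=> t _; rewrite exprMn exprVn -!exprM !(mulnC t).
case: ifPn => ab.
  rewrite (eq_bigr (fun=> 1)) ?sumr_const ?card_ord// => t _.
  move: ab; rewrite -(eq_prim_root_expr wP) => /eqP ->.
  by rewrite divff ?expf_neq0// expr1n.
set z := _ / _; have zN : z ^+ N = 1.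
  by rewrite /z exprMn exprVn -!exprM !(mulnC _ N) !exprM (prim_expr_order wP) !expr1n divr1.
have z1 : z - 1 != 0.
  rewrite subr_eq0 /z; apply: contra ab => /eqP /(congr1 ( *%R^~ (w ^+ b))).
  by rewrite divfK ?expf_neq0// mul1r => /eqP; rewrite (eq_prim_root_expr wP).
by apply: (mulfI z1); rewrite mulr0 -subrX1 zN subrr.
Qed.

Lemma character_orthogonal (a b : 'I_n -> nat) :
  \sum_(t : {ffun 'I_n -> 'I_N}) character a t / character b t =
  if [forall i, a i == b i %[mod N]] then (N ^ n)%:R else 0.
Proof.
under eq_bigr => t _ do rewrite /character -prodfV -big_split/=.
rewrite -(bigA_distr_bigA (fun i (t : 'I_N) => (w ^+ t) ^+ a i / (w ^+ t) ^+ b i)).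
under eq_bigr do rewrite sum_unity_root.
case: ifPn => [/forallP ab|/forallPn[i abi]].
  by rewrite (eq_bigr (fun=> N%:R)) ?prodr_const ?card_ord ?natrX// => i _; rewrite ab.
by rewrite (bigD1 i)//= (negPf abi) mul0r.
Qed.

Implicit Types (a b : {ffun 'I_n -> 'I_N}) (c : {ffun 'I_n -> 'I_N} -> R[i]).

Lemma parseval c :
  \sum_(t : {ffun 'I_n -> 'I_N}) normc (\sum_a c a * character (exps a) t) ^+ 2 =
  (N ^ n)%:R * \sum_a normc (c a) ^+ 2.
Proof.
apply: complexI; rewrite rmorphM !rmorph_sum rmorph_nat /=.
under eq_bigr => t _.
  rewrite normc_sqr rmorph_sum/= big_distrlr/=.
  under eq_bigr => a _.
    under eq_bigr => b _.
      rewrite rmorphM/= (conjc_unit (normc_character _ _)) mulrACA.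
      over.
    over.
  over.
rewrite exchange_big/= big_distrr/=; apply: eq_bigr => a _.
rewrite exchange_big/= (bigD1 a)//= -mulr_sumr character_orthogonal.
rewrite ifT; last by apply/forallP.
rewrite big1 ?addr0 ?normc_sqr 1?mulrC// => b ba.
rewrite -mulr_sumr character_orthogonal ifF ?mulr0//.
apply/negP => /forallP ab; case/eqP: ba; apply/ffunP => i.
by apply/val_inj => /=; move: (ab i); rewrite /exps !modn_small// => /eqP.
Qed.

End torus.

(** * Hypercontractivity *)

Section cauchy_schwarz.
Variables (R : realType) (I : finType) (P : pred I).
Implicit Types f g : I -> R.

Lemma sum_cauchy_schwarz f g :
  (\sum_(i | P i) f i * g i) ^+ 2 <=
  (\sum_(i | P i) f i ^+ 2) * (\sum_(i | P i) g i ^+ 2).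
Proof.
have : 0 <= \sum_(i | P i) \sum_(j | P j) (f i * g j - f j * g i) ^+ 2.
  by apply: sumr_ge0 => i _; apply: sumr_ge0 => j _; exact: sqr_ge0.
have -> : \sum_(i | P i) \sum_(j | P j) (f i * g j - f j * g i) ^+ 2 =
  2 * ((\sum_(i | P i) f i ^+ 2) * (\sum_(i | P i) g i ^+ 2) -
       (\sum_(i | P i) f i * g i) ^+ 2).
  rewrite expr2 mulrBr !big_distrlr/=.
  pose A i j := f i ^+ 2 * g j ^+ 2.
  rewrite [X in 2 * X](_ : _ = \sum_(i | P i) \sum_(j | P j) A i j)//.
  rewrite (_ : 2 * (\sum_(i | P i) \sum_(j | P j) A i j) =
    \sum_(i | P i) \sum_(j | P j) (A i j + A j i)); last first.
    rewrite mulr_natl mulr2n [X in _ + X]exchange_big/= -big_split/=; apply: eq_bigr => i _.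
    by rewrite -big_split.
  rewrite mulr_sumr -sumrB; apply: eq_bigr => i _.
  rewrite mulr_sumr -sumrB; apply: eq_bigr => j _.
  rewrite /A; ring.
by rewrite pmulr_rge0// subr_ge0.
Qed.

Lemma sum_cauchy_schwarz_sqrt f g :
  \sum_(i | P i) f i * g i <=
  Num.sqrt (\sum_(i | P i) f i ^+ 2) * Num.sqrt (\sum_(i | P i) g i ^+ 2).
Proof.
rewrite -sqrtrM; last by apply: sumr_ge0 => i _; exact: sqr_ge0.
apply: (le_trans (ler_norm _)); rewrite -sqrtr_sqr ler_wsqrtr//.
exact: sum_cauchy_schwarz.
Qed.

(* The interpolation [|f|_2^3 <= |f|_1 |f|_4^2], from two Cauchy-Schwarz
   estimates of [f^2] and of [f^3]. *)
Lemma sum_interpolation f : (forall i, 0 <= f i) ->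
  (\sum_(i | P i) f i ^+ 2) ^+ 3 <=
  (\sum_(i | P i) f i) ^+ 2 * (\sum_(i | P i) f i ^+ 4).
Proof.
move=> f0; set s1 := \sum_(i | P i) f i; set s2 := \sum_(i | P i) f i ^+ 2.
set s4 := \sum_(i | P i) f i ^+ 4; pose s3 := \sum_(i | P i) f i ^+ 3.
have s_ge0 k : 0 <= \sum_(i | P i) f i ^+ k.
  by apply: sumr_ge0 => i _; exact: exprn_ge0.
have h13 : s2 ^+ 2 <= s1 * s3.
  have := sum_cauchy_schwarz (fun i => Num.sqrt (f i)) (fun i => Num.sqrt (f i ^+ 3)).
  rewrite [X in X ^+ 2 <= _](eq_bigr (fun i => f i ^+ 2)); last first.
    by move=> i _; rewrite -sqrtrM// -exprS -[4%N]/(2 * 2)%N exprM sqrtr_sqr ger0_norm ?exprn_ge0.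
  rewrite [X in _ <= X * _](eq_bigr f); last by move=> i _; rewrite sqr_sqrtr.
  by rewrite [X in _ <= _ * X](eq_bigr (fun i => f i ^+ 3)) // => i _; rewrite sqr_sqrtr ?exprn_ge0.
have h24 : s3 ^+ 2 <= s2 * s4.
  have := sum_cauchy_schwarz f (fun i => f i ^+ 2).
  rewrite [X in X ^+ 2 <= _](eq_bigr (fun i => f i ^+ 3)); last by move=> i _; rewrite -exprS.
  by rewrite [X in _ <= _ * X](eq_bigr (fun i => f i ^+ 4)) // => i _; rewrite -exprM.
have s2_ge0 : 0 <= s2 by exact: s_ge0.
have s3_ge0 : 0 <= s3 by exact: s_ge0.
have s4_ge0 : 0 <= s4 by exact: s_ge0.
have s1_ge0 : 0 <= s1 by exact: sumr_ge0.
have [->|s2_neq0] := eqVneq s2 0; first by rewrite expr0n mulr_ge0 ?sqr_ge0.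
have s2_gt0 : 0 < s2 by rewrite lt_neqAle eq_sym s2_neq0.
rewrite -(ler_pM2l s2_gt0) -exprS.
apply: (@le_trans _ _ ((s1 * s3) ^+ 2)).
  by rewrite -[4%N]/(2 * 2)%N exprM lerXn2r// nnegrE ?sqr_ge0 ?mulr_ge0.
by rewrite exprMn [leRHS]mulrCA ler_wpM2l ?sqr_ge0.
Qed.

End cauchy_schwarz.

Section hypercontractivity.
Variables (R : realType) (N : nat) (w : R[i]) (n m : nat).
Hypotheses (N_gt2m : (2 * m < N)%N) (wP : N.-primitive_root w).
Let N_gt0 : (0 < N)%N. Proof. exact: leq_ltn_trans N_gt2m. Qed.

Implicit Types (a b g : {ffun 'I_n -> 'I_N}) (c : {ffun 'I_n -> 'I_N} -> R[i]).

Definition degree a : nat := \sum_i a i.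

Definition add_mod a b : {ffun 'I_n -> 'I_N} :=
  [ffun i => Ordinal (ltn_pmod (a i + b i) N_gt0)].

Lemma le_degree a i : (a i <= degree a)%N.
Proof. by rewrite /degree (bigD1 i)//= leq_addr. Qed.

Lemma character_add_mod a b (t : 'I_n -> 'I_N) :
  character w (exps (add_mod a b)) t =
  character w (exps a) t * character w (exps b) t.
Proof.
rewrite /character -big_split; apply: eq_bigr => i _ /=.
rewrite /exps ffunE/= -exprD -!exprM mulnC exprM prim_expr_mod// -exprM mulnC.
by [].
Qed.

Definition decompositions g : {set {ffun 'I_n -> 'I_N} * {ffun 'I_n -> 'I_N}} :=
  [set p | [&& add_mod p.1 p.2 == g, degree p.1 == m & degree p.2 == m]].

(** The first component determines the second and lies in the box below [g], which has [\prod_i (g_i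
    + 1) <= \prod_i 2^(g_i) = 2^(2m)] points. The dimension [n] does not enter. *)
Lemma card_decompositions g : (#|decompositions g| <= 4 ^ m)%N.
Proof.
(* Two exponents of degree [m] add up without wrapping around, because [2 m < N]. *)
have addE p i : p \in decompositions g -> (p.1 i + p.2 i)%N = g i.
  rewrite inE => /and3P[/eqP <- /eqP d1 /eqP d2]; rewrite ffunE /= modn_small//.
  apply: leq_ltn_trans N_gt2m; rewrite mul2n -addnn.
  by rewrite -[X in (_ <= X + _)%N]d1 -[X in (_ <= _ + X)%N]d2 leq_add ?le_degree.
have [->|[p pg]] := set_0Vmem (decompositions g); first by rewrite cards0.
have dg : degree g = (2 * m)%N.
  rewrite /degree (eq_bigr (fun i => (p.1 i + p.2 i)%N)); last first.
    by move=> i _; rewrite addE.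
  rewrite big_split/=; move: pg; rewrite inE => /and3P[_ /eqP d1 /eqP d2].
  by rewrite -/(degree p.1) -/(degree p.2) d1 d2 addnn mul2n.
pose F i : pred 'I_N := [pred x : 'I_N | (x <= g i)%N].
have inj : {in decompositions g &, injective fst}.
  move=> [a b] [a' b'] /= abg ab'g aa'; subst a'; congr pair.
  apply/ffunP => i; apply/val_inj => /=.
  by have := addE _ i abg; have := addE _ i ab'g => /= <- /addnI.
rewrite -(card_in_imset inj).
apply: (@leq_trans #|family F|).
  apply/subset_leq_card/fintype.subsetP => a /imsetP[q qg ->].
  apply/familyP => i; rewrite inE.
  by rewrite -(addE _ i qg) leq_addr.
rewrite card_family foldrE big_map big_enum/=.
apply: (@leq_trans (\prod_i 2 ^ g i)%N); last first.
  by rewrite -expn_sum -/(degree g) dg expnM.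
apply: leq_prod => i _; apply: (@leq_trans (g i).+1); last exact: ltn_expl.
rewrite -[X in (_ <= X)%N]card_ord.
pose h (x : 'I_N) : 'I_(g i).+1 := inord x.
rewrite -(@card_in_image _ _ h (F i)) ?max_card//.
move=> x y; rewrite !inE => xg yg /(congr1 val); rewrite /h /= !inordK// => xy.
exact/val_inj.
Qed.

(** Parseval is applied to the square of the polynomial, whose coefficient at [g] is a sum over
    [decompositions g]; Cauchy-Schwarz on each such sum costs its number of terms, at most [4^m]. *)
Lemma fourth_moment c : (forall a, degree a != m -> c a = 0) ->
  \sum_(t : {ffun 'I_n -> 'I_N})
     normc (\sum_a c a * character w (exps a) t) ^+ 4 <=
  (N ^ n)%:R * (4 ^+ m * (\sum_a normc (c a) ^+ 2) ^+ 2).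
Proof.
move=> c0.
pose d g := \sum_(p in decompositions g) c p.1 * c p.2.
have fE (t : {ffun 'I_n -> 'I_N}) :
    (\sum_a c a * character w (exps a) t) ^+ 2 =
    \sum_g d g * character w (exps g) t.
  rewrite expr2 big_distrlr/= pair_big/=.
  rewrite (partition_big (fun p => add_mod p.1 p.2) xpredT)//=.
  apply: eq_bigr => g _; rewrite /d mulr_suml [RHS]big_mkcond [LHS]big_mkcond/=.
  apply: eq_bigr => p _; rewrite inE; case: eqP => //= <-.
  rewrite character_add_mod mulrACA.
  have [_|/c0 ->] := eqVneq (degree p.1) m; last by rewrite !mul0r.
  by have [_//|/c0 ->] := eqVneq (degree p.2) m; rewrite mulr0 mul0r.
under eq_bigr => t _ do rewrite -[4%N]/(2 * 2)%N exprM -normcX fE.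
rewrite (parseval N_gt0 wP) ler_wpM2l//.
apply: (@le_trans _ _
  (\sum_g 4 ^+ m * \sum_(p in decompositions g) normc (c p.1) ^+ 2 * normc (c p.2) ^+ 2)).
  apply: ler_sum => g _.
  apply: (@le_trans _ _ ((\sum_(p in decompositions g) 1 * (normc (c p.1) * normc (c p.2))) ^+ 2)).
    rewrite lerXn2r ?nnegrE ?normc_ge0//.
      by apply: sumr_ge0 => p _; rewrite !mulr_ge0 ?normc_ge0.
    apply: (le_trans (normc_sum _ _ _)); apply: ler_sum => p _.
    by rewrite normcM mul1r.
  apply: (le_trans (sum_cauchy_schwarz _ _ _)).
  rewrite [X in X * _](eq_bigr (fun=> 1)) => [|? _]; last by rewrite expr1n.
  rewrite [X in _ * X](eq_bigr (fun p => normc (c p.1) ^+ 2 * normc (c p.2) ^+ 2)); last first.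
    by move=> p _; rewrite exprMn.
  rewrite ler_wpM2r//; first by apply: sumr_ge0 => p _; rewrite mulr_ge0 ?sqr_ge0.
  by rewrite sumr_const -natrX ler_nat card_decompositions.
rewrite -mulr_sumr ler_wpM2l ?exprn_ge0// expr2 big_distrlr/= pair_big/=.
rewrite [X in _ <= X](partition_big (fun p => add_mod p.1 p.2) xpredT)//=.
apply: ler_sum => g _; rewrite [X in X <= _]big_mkcond [X in _ <= X]big_mkcond/=.
apply: ler_sum => p _; rewrite inE; case: eqP => //= _.
by case: ifP => _; [exact: lexx|apply: mulr_ge0; exact: sqr_ge0].
Qed.

(** With [T] points, [A] the square sum of the coefficients and [S] the sum of the moduli,
    interpolation between the first and fourth moments reads [(T A)^3 <= S^2 T 4^m A^2]; dividing by
    [T A^2] leaves [T^2 A <= 4^m S^2]. *)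
Lemma hypercontractivity c : (forall a, degree a != m -> c a = 0) ->
  (N ^ n)%:R * Num.sqrt (\sum_a normc (c a) ^+ 2) <=
  2 ^+ m * \sum_(t : {ffun 'I_n -> 'I_N})
              normc (\sum_a c a * character w (exps a) t).
Proof.
move=> c0; set A := \sum_a normc (c a) ^+ 2; set S := \sum_t _.
set T : R := (N ^ n)%:R.
have T_gt0 : 0 < T by rewrite ltr0n expn_gt0 N_gt0.
have A_ge0 : 0 <= A by apply: sumr_ge0 => a _; exact: sqr_ge0.
have S_ge0 : 0 <= S by apply: sumr_ge0 => a _; exact: normc_ge0.
have : (T * A) ^+ 3 <= S ^+ 2 * (T * (4 ^+ m * A ^+ 2)).
  rewrite -(parseval N_gt0 wP).
  apply: (le_trans (sum_interpolation _ _)); first by move=> t; exact: normc_ge0.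
  by rewrite ler_wpM2l ?sqr_ge0 ?fourth_moment.
have [->|A_neq0] := eqVneq A 0; first by rewrite sqrtr0 mulr0 mulr_ge0 ?exprn_ge0.
have A_gt0 : 0 < A by rewrite lt_neqAle eq_sym A_neq0.
move=> h; have {}h : T ^+ 2 * A <= 4 ^+ m * S ^+ 2.
  have TA : 0 < T * A ^+ 2 by rewrite mulr_gt0 ?exprn_gt0.
  rewrite -(ler_pM2l TA); apply: le_trans (le_trans h _).
    by rewrite le_eqVlt; apply/orP; left; apply/eqP; ring.
  by rewrite le_eqVlt; apply/orP; left; apply/eqP; ring.
rewrite -(@ler_sqr _ (T * Num.sqrt A)) ?nnegrE ?mulr_ge0 ?sqrtr_ge0 ?exprn_ge0 ?(ltW T_gt0)//.
by rewrite !exprMn sqr_sqrtr// -exprM mulnC exprM (_ : 2 ^+ 2 = 4)//; ring.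
Qed.

End hypercontractivity.

(** * Partial derivatives *)

Section derivative_bound.
Variable R : realType.

(** Cauchy's estimate without integrals: for degree below [N], averaging [q (w^t) w^(-kt)] over the
    [N]-th roots of unity isolates the coefficient exactly. *)
Lemma normc_coef_le (N : nat) (w : R[i]) (q : {poly R[i]}) (k : nat) (M : R) :
  N.-primitive_root w -> (size q <= N)%N -> (k < N)%N ->
  (forall t : 'I_N, normc q.[w ^+ t] <= M) -> normc q`_k <= M.
Proof.
move=> wP sq kN qM; have N0 : (0 < N)%N by exact: leq_ltn_trans kN.
have w1 : normc w = 1 := normc_unity N0 (prim_expr_order wP).
have : \sum_(t < N) q.[w ^+ t] / (w ^+ t) ^+ k = N%:R * q`_k.
  under eq_bigr => t _.
    rewrite (horner_coef_wide _ sq) mulr_suml.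
    under eq_bigr do rewrite -mulrA.
    over.
  rewrite exchange_big/= (bigD1 (Ordinal kN))//= -mulr_sumr sum_unity_root//.
  rewrite eqxx big1 ?addr0 1?mulrC// => i ik; rewrite -mulr_sumr sum_unity_root//.
  by rewrite !modn_small// ifF ?mulr0//; apply/negbTE.
move=> /(congr1 (@normc R)); rewrite normcM normc_nat => qk.
have N0R : 0 < N%:R :> R by rewrite ltr0n.
rewrite -(ler_pM2l N0R) -qk; apply: (le_trans (normc_sum _ _ _)).
apply: (@le_trans _ _ (\sum_(t < N) M)); last by rewrite sumr_const card_ord mulr_natl.
by apply: ler_sum => t _; rewrite normcM normcV !normcX w1 !expr1n invr1 mulr1.
Qed.

(** The linear coefficient is here a logarithmic derivative at 0, hence additive on products. *)
Lemma coef01_prod (I : Type) (r : seq I) (f : I -> {poly R[i]}) :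
  (forall i, (f i)`_0 = 1) ->
  (\prod_(i <- r) f i)`_0 = 1 /\
  (\prod_(i <- r) f i)`_1 = \sum_(i <- r) (f i)`_1.
Proof.
move=> f0; elim: r => [|i r [IH0 IH1]]; first by rewrite !big_nil !coef1.
by rewrite !big_cons !coefM !big_ord_recr !big_ord0/= !add0r f0 IH0 IH1 !mulr1 mul1r addrC.
Qed.

Lemma coef01_exp (f : {poly R[i]}) n : f`_0 = 1 ->
  (f ^+ n)`_0 = 1 /\ (f ^+ n)`_1 = f`_1 *+ n.
Proof.
move=> f0; have := @coef01_prod _ (nseq n tt) (fun=> f) (fun=> f0).
by rewrite !big_const_seq count_predT size_nseq -!Monoid.iteropE.
Qed.

Lemma size_prod_exp_linear (I : Type) (r : seq I) (u : I -> R[i]) (a : I -> nat) :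
  (size (\prod_(i <- r) (1 + u i *: 'X) ^+ a i)%R <= (\sum_(i <- r) a i).+1)%N.
Proof.
have s1 i : (size (1 + u i *: 'X : {poly R[i]})%R <= 2)%N.
  apply: (leq_trans (size_polyD _ _)); rewrite size_poly1 geq_max/=.
  by apply: (leq_trans (size_scale_leq _ _)); rewrite size_polyX.
elim: r => [|i r IH]; first by rewrite !big_nil size_poly1.
rewrite !big_cons; apply: (leq_trans (size_polyMleq _ _)).
have : (size ((1 + u i *: 'X : {poly R[i]}) ^+ a i)%R <= (a i).+1)%N.
  apply: (leq_trans (size_poly_exp_leq _ _)); rewrite ltnS.
  by rewrite -[X in (_ <= X)%N]mul1n leq_mul2r; case: (size _) (s1 i) => [|[|[]]]//=; rewrite orbT.
by move=> h; rewrite -subn1 leq_subLR (leq_trans (leq_add h IH))// addSn addnS.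
Qed.

End derivative_bound.

Section partial_derivatives.
Variables (R : realType) (N : nat) (w : R[i]) (n m : nat).
Hypotheses (m_gt0 : (0 < m)%N) (N_gt2m : (2 * m < N)%N).
Hypothesis wP : N.-primitive_root w.
Let N_gt0 : (0 < N)%N. Proof. exact: leq_ltn_trans N_gt2m. Qed.

Variables (c : {ffun 'I_n -> 'I_N} -> R[i]) (M : R).
Hypothesis c0 : forall a, degree a != m -> c a = 0.
Hypothesis cM : forall v : 'I_n -> R[i], (forall i, normc (v i) <= 2) ->
  normc (\sum_a c a * \prod_i v i ^+ a i) <= M.

(* With unimodular [u], the coefficient of [X] in [p (v * (1 + u X))] is
   [\sum_k u_k v_k (dp/dv_k) (v)]; the [u_k] are the phases that make it equal
   to [\sum_k |v_k (dp/dv_k) (v)|]. *)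
Lemma sum_partial_derivatives_le (t : {ffun 'I_n -> 'I_N}) :
  \sum_k normc (\sum_a (c a * (a k)%:R) * character w (exps a) t) <= M.
Proof.
pose E k := \sum_a (c a * (a k)%:R) * character w (exps a) t.
(* Division by zero yields 0, so [u k] vanishes where [E k] does and is unimodular elsewhere. *)
pose u k := (normc (E k))%:C / E k.
have u1 k : normc (u k) <= 1.
  rewrite normcM normcV normc_real ger0_norm ?normc_ge0//.
  by have [->|E0] := eqVneq (E k) 0; rewrite ?normc0 ?mul0r// divff// normc_eq0.
have uE k : u k * E k = (normc (E k))%:C.
  by rewrite /u; have [->|E0] := eqVneq (E k) 0; rewrite ?normc0 ?mulr0// divfK.
pose q : {poly R[i]} := \sum_a (c a * character w (exps a) t) *:
   \prod_i (1 + u i *: 'X) ^+ a i.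
have q1 : q`_1 = (\sum_k normc (E k))%:C.
  rewrite rmorph_sum /= -(eq_bigr _ (fun k _ => uE k)) /q coef_sum.
  rewrite [RHS](eq_bigr (fun k => \sum_a
    (c a * character w (exps a) t) * (u k *+ a k))); last first.
    move=> k _; rewrite mulr_sumr; apply: eq_bigr => a _.
    by rewrite -[_ *+ a k]mulr_natr; ring.
  rewrite exchange_big; apply: eq_bigr => a _; rewrite coefZ -mulr_sumr; congr (_ * _).
  have f0 i : (1 + u i *: 'X : {poly R[i]})`_0 = 1.
    by rewrite coefD coef1 coefZ coefX mulr0 addr0.
  have [|_ ->] := @coef01_prod R _ (index_enum 'I_n) (fun i => (1 + u i *: 'X) ^+ a i).
    by move=> i; case: (coef01_exp (a i) (f0 i)).
  apply: eq_bigr => i _; case: (coef01_exp (a i) (f0 i)) => _ ->.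
  by rewrite coefD coef1 coefZ coefX mulr1 add0r.
have -> : \sum_k normc (E k) = normc q`_1.
  by rewrite q1 normc_real ger0_norm// sumr_ge0// => k _; exact: normc_ge0.
apply: (normc_coef_le wP).
- apply: (leq_trans (size_sum _ _ _)); apply/bigmax_leqP => a _.
  have [am|/c0 ->] := eqVneq (degree a) m; last by rewrite mul0r scale0r size_poly0.
  apply: (leq_trans (size_scale_leq _ _)).
  apply: (leq_trans (size_prod_exp_linear _ _ _)).
  rewrite -/(degree a) am; lia.
- lia.
- move=> s; have w1 : normc w = 1 := normc_unity N_gt0 (prim_expr_order wP).
  have -> : q.[w ^+ s] =
      \sum_a c a * \prod_i ((w ^+ t i) * (1 + u i * w ^+ s)) ^+ a i.
    rewrite /q horner_sum; apply: eq_bigr => a _.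
    rewrite hornerZ horner_prod -mulrA; congr (_ * _).
    rewrite /character -big_split; apply: eq_bigr => i _ /=.
    by rewrite horner_exp exprMn hornerD hornerZ hornerX hornerC.
  (* The points [w^(t_i) (1 + u_i w^s)] have modulus at most 2, hence the radius in [cM]. *)
  apply: cM => i; rewrite normcM normcX w1 expr1n mul1r.
  apply: (le_trans (le_normcD _ _)); rewrite normc1 normcM normcX w1 expr1n mulr1.
  by have := u1 i; lra.
Qed.

(** Hypercontractivity passes from [L^2] to [L^1] for each [k] separately, because in [L^1] the sum
    over [k] moves inside the sum over the torus, where the pointwise bound applies. *)
Lemma sum_partial_norms_le :
  \sum_k Num.sqrt (\sum_a normc (c a * (a k)%:R) ^+ 2) <= 2 ^+ m * M.
Proof.
have T_gt0 : 0 < (N ^ n)%:R :> R by rewrite ltr0n expn_gt0 N_gt0.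
rewrite -(ler_pM2l T_gt0) mulr_sumr.
apply: (@le_trans _ _ (\sum_k 2 ^+ m * \sum_(t : {ffun 'I_n -> 'I_N})
   normc (\sum_a (c a * (a k)%:R) * character w (exps a) t))).
  apply: ler_sum => k _; apply: (hypercontractivity N_gt2m wP) => a am.
  by rewrite (c0 am) mul0r.
rewrite -mulr_sumr mulrCA ler_wpM2l ?exprn_ge0// exchange_big/=.
apply: (@le_trans _ _ (\sum_(t : {ffun 'I_n -> 'I_N}) M)).
  by apply: ler_sum => t _; exact: sum_partial_derivatives_le.
by rewrite sumr_const card_ffun !card_ord mulr_natl.
Qed.

End partial_derivatives.

(** * The finite-dimensional estimate *)

Section rankin.
Variable R : realType.

Section roots.
Variables (m : nat) (y : nat -> R).
Hypotheses (m_gt0 : (0 < m)%N) (y_ge0 : forall j, 0 <= y j).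
Hypothesis yX : forall j, y j ^+ m = j%:R.

Lemma root_seq_ge1 j : 1 <= y j.+1.
Proof.
rewrite -(@ler_pXn2r _ m m_gt0) ?nnegrE//.
by rewrite yX expr1n ler1n.
Qed.

Lemma root_seq_homo i j : (i <= j)%N -> y i <= y j.
Proof. by move=> ij; rewrite -(@ler_pXn2r _ m m_gt0) ?nnegrE// !yX ler_nat. Qed.

(** Here [y j] is [j^(1/m)], and the bound is a discrete integral of [t^(1/m - 1)]. Writing
    [1 = y_(n+1)^m - y_n^m] as [y_(n+1) - y_n] times [m] terms, each at most [y_(n+1)^(m-1)], makes
    the sum telescope. *)
Lemma sum_inv_root_seq_le n : \sum_(i < n) (y i.+1 ^+ m.-1)^-1 <= m%:R * y n.
Proof.
elim: n => [|n IH]; first by rewrite big_ord0 mulr_ge0.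
rewrite big_ord_recr/=; apply: (@le_trans _ _ (m%:R * y n + m%:R * (y n.+1 - y n))); last first.
  by rewrite -mulrDr addrC subrK.
rewrite lerD//.
have y1 := root_seq_ge1 n.
have y_gt0 : 0 < y n.+1 ^+ m.-1 by rewrite exprn_gt0// (lt_le_trans ltr01).
rewrite -(ler_pM2r y_gt0) mulVf ?gt_eqF//.
have h1 : y n.+1 ^+ m - y n ^+ m = 1 by rewrite !yX -natrB// subSnn.
have yn : y n <= y n.+1 by exact: root_seq_homo.
rewrite -[X in X <= _]h1 subrXX.
rewrite [leRHS](_ : _ = (y n.+1 - y n) * (m%:R * y n.+1 ^+ m.-1)); last by ring.
rewrite ler_wpM2l ?subr_ge0//.
apply: (@le_trans _ _ (\sum_(i < m) y n.+1 ^+ m.-1)); last first.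
  by rewrite sumr_const card_ord mulr_natl.
apply: ler_sum => i _; have im := ltn_ord i.
have -> : y n.+1 ^+ m.-1 = y n.+1 ^+ (m.-1 - i) * y n.+1 ^+ i.
  by rewrite -exprD subnK//; lia.
by rewrite ler_pM ?exprn_ge0// ?lerXn2r ?nnegrE//.
Qed.

End roots.

Lemma geometric_sum_le (r : R) n : 0 <= r -> r <= 2^-1 ->
  \sum_(i < n) r ^+ i <= 1 + 2 * r.
Proof.
move=> r0 r1; have : (r - 1) * \sum_(i < n) r ^+ i = r ^+ n - 1 by rewrite subrX1.
have := exprn_ge0 n r0; set S := \sum_(i < n) _; set p := r ^+ n => p0 e.
have : (1 - r) * S <= (1 - r) * (1 + 2 * r) by nra.
by rewrite ler_pM2l//; lra.
Qed.

Lemma geometric_sum_pos_le (r : R) n : 0 <= r -> r <= 2^-1 ->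
  \sum_(i < n | (0 < i)%N) r ^+ i <= 2 * r.
Proof.
case: n => [|n] r0 r1; first by rewrite big_ord0; lra.
have := geometric_sum_le n.+1 r0 r1; rewrite big_ord_recl expr0 => h.
by rewrite big_mkcond big_ord_recl/= add0r; lra.
Qed.

Section last_variable.
Variables (N n m : nat) (y : nat -> R) (x : 'I_n -> R) (D : R).
Hypotheses (m_gt0 : (0 < m)%N) (y_ge0 : forall j, 0 <= y j).
Hypothesis yX : forall j, y j ^+ m = j%:R.
Hypotheses (D_ge0 : 0 <= D) (x_ge0 : forall i, 0 <= x i).
Hypothesis xD : forall i : 'I_n, x i <= D / y i.+1 ^+ m.-1.

Definition last_var (k : 'I_n) : pred {ffun 'I_n -> 'I_N} :=
  [pred a | [&& degree a == m, (0 < a k)%N & [forall i : 'I_n, (k < i)%N ==> (a i == 0 :> nat)]]].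

(* Rankin's trick: a monomial of degree [m] in [z] is [t ^- m] times the
   monomial in [t z], and the sum of the latter over all exponents is a product
   of geometric series; [t = 1 / (2 y_(k+1))] is the right order of magnitude. *)
Lemma sum_last_var_le (k : 'I_n) :
  \sum_(a | last_var k a) \prod_i x i ^+ a i <= D ^+ m * (2 * expR 1) ^+ m.
Proof.
pose z (i : nat) := (y i.+1 ^+ m.-1)^-1.
have y1 i : 1 <= y i.+1 by exact: (root_seq_ge1 m_gt0 y_ge0 yX).
have y_gt0 i : 0 < y i.+1 by rewrite (lt_le_trans ltr01).
have z_ge0 i : 0 <= z i by rewrite invr_ge0 exprn_ge0.
have z_le1 i : z i <= 1 by rewrite invf_le1 ?exprn_gt0// exprn_ege1.
pose Y := y k.+1; pose t := (2 * Y)^-1.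
have Y_gt0 : 0 < Y by exact: y_gt0.
have t_gt0 : 0 < t by rewrite invr_gt0 mulr_gt0.
have t_le : t <= 2^-1 by rewrite lef_pV2 ?posrE ?mulr_gt0// ler_peMr// y1.
have tz_ge0 i : 0 <= t * z i by rewrite mulr_ge0// ltW.
have tz_le i : t * z i <= 2^-1.
  by apply: le_trans t_le; rewrite ler_piMr// ltW.
(* The constraints of [last_var] other than the degree concern one variable at a time: free
   exponents before [k], positive at [k], zero after. [F] encodes them so that the sum factors. *)
pose F (i : 'I_n) (s : 'I_N) : R :=
  if [|| (i < k)%N, (i == k) && (0 < s)%N | (k < i)%N && (s == 0 :> nat)]
  then (t * z i) ^+ s else 0.
(* Before [k] a geometric series is at most [1 + 2 t z_i <= exp (2 t z_i)]; at [k] its constant term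
   is missing, which leaves the gain [2 t z_k]. *)
pose G (i : 'I_n) : R :=
  (if (i < k)%N then expR (2 * (t * z i)) else 1) * (if i == k then 2 * (t * z i) else 1).
have F_ge0 i s : 0 <= F i s by rewrite /F; case: ifP => // _; exact: exprn_ge0.
have FG i : \sum_s F i s <= G i.
  rewrite /F /G; have [ik|ki|ik] := ltngtP i k => /=.
  - rewrite ifF ?mulr1; last by apply/negbTE; rewrite -val_eqE/= neq_ltn ik.
    apply: (le_trans (geometric_sum_le _ (tz_ge0 _) (tz_le _))).
    exact: expR_ge1Dx.
  - rewrite ifF ?mulr1; last by apply/negbTE; rewrite -val_eqE/= neq_ltn ki orbT.
    rewrite (_ : (i == k) = false) /=; last by apply/negbTE; rewrite -val_eqE/= neq_ltn ki orbT.
    rewrite -big_mkcond/=; case: N => [|N']; first by rewrite big_ord0 ler01.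
    rewrite (big_pred1 ord0) ?expr0// => s /=; by rewrite -val_eqE.
  - have -> : i = k by exact/val_inj.
    rewrite eqxx/= mul1r; under eq_bigr do rewrite orbF.
    by rewrite -big_mkcond/= geometric_sum_pos_le.
(* [2 t z_k = Y^(-m)] cancels the power [Y^m] paid for [t], and [exp m] will bound the product of
   the exponentials. *)
have -> : D ^+ m * (2 * expR 1) ^+ m =
    D ^+ m * (2 * Y) ^+ m * (2 * (t * z k) * expR m%:R).
  have -> : expR m%:R = expR 1 ^+ m :> R by rewrite -[m%:R]mulr1 expRM_natl.
  rewrite !exprMn /t /z -/Y invfM.
  have -> : Y ^+ m = Y * Y ^+ m.-1 by rewrite -exprS prednK.
  have Yn0 : Y ^+ m.-1 != 0 by rewrite expf_neq0// gt_eqF.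
  have Y0 : Y != 0 by rewrite gt_eqF.
  by field; rewrite ?Y0 ?Yn0.
apply: (@le_trans _ _ (\sum_(a | last_var k a) D ^+ m * (2 * Y) ^+ m * \prod_i F i (a i))).
  apply: ler_sum => a /and3P[/eqP da ak /forallP ai].
  have -> : D ^+ m * (2 * Y) ^+ m * \prod_i F i (a i) = \prod_(i < n) (D * z i) ^+ a i.
    rewrite -exprMn -da /degree expr_sum -big_split; apply: eq_bigr => i _ /=.
    rewrite /F ifT; last first.
      have := ai i; case: (ltngtP i k) => //= [ki ->//|ik _].
        by rewrite orbT.
      by rewrite (val_inj ik) eqxx ak.
    rewrite -exprMn; congr (_ ^+ _); rewrite /t.
    by field; rewrite gt_eqF.
  apply: ler_prod => i _; rewrite exprn_ge0// lerXn2r ?nnegrE ?mulr_ge0//.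
rewrite -mulr_sumr ler_wpM2l ?mulr_ge0 ?exprn_ge0 ?mulr_ge0 ?(ltW Y_gt0)//.
apply: (@le_trans _ _ (\sum_(a : {ffun 'I_n -> 'I_N}) \prod_i F i (a i))).
  rewrite [leLHS]big_mkcond; apply: ler_sum => a _; case: ifP => // _.
  by apply: prodr_ge0 => i _.
rewrite -bigA_distr_bigA/=; apply: (@le_trans _ _ (\prod_i G i)).
  by apply: ler_prod => i _; rewrite FG andbT sumr_ge0.
rewrite /G big_split/= -!big_mkcond/= big_pred1_eq mulrC ler_wpM2l ?(mulr_ge0 _ (tz_ge0 _))//.
rewrite -expR_sum ler_expR -mulr_sumr -mulr_sumr mulrA.
have -> : \sum_(i < n | (i < k)%N) z i = \sum_(i < k) z i.
  by rewrite -(big_ord_widen n z (ltnW (ltn_ord k))).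
(* [2 t = 1 / Y] and the [z_i] before [k] add up to at most [m Y], so the exponent is at most
   [m]. *)
apply: (@le_trans _ _ (2 * t * (m%:R * Y))).
  rewrite ler_wpM2l ?mulr_ge0 ?(ltW t_gt0)//.
  apply: (le_trans (sum_inv_root_seq_le m_gt0 y_ge0 yX _)).
  by rewrite ler_wpM2l// (root_seq_homo m_gt0 y_ge0 yX).
rewrite le_eqVlt /t; apply/orP; left; apply/eqP.
by field; rewrite gt_eqF.
Qed.

End last_variable.
End rankin.

Section finite_dimensional_bound.
Variables (R : realType) (n m : nat) (y : nat -> R) (z : 'I_n -> R) (B M : R).
Hypotheses (m_gt0 : (0 < m)%N) (y_ge0 : forall j, 0 <= y j).
Hypothesis yX : forall j, y j ^+ m = j%:R.
Hypotheses (B_ge0 : 0 <= B) (z_ge0 : forall i, 0 <= z i).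
Hypothesis zB : forall i : 'I_n, z i ^+ 2 <= B ^+ 2 / y i.+1 ^+ m.-1.
Let N := (2 * m).+1.
Variable c : {ffun 'I_n -> 'I_N} -> R[i].
Hypothesis c0 : forall a, degree a != m -> c a = 0.
Hypothesis cM : forall v : 'I_n -> R[i], (forall i, normc (v i) <= 2) ->
  normc (\sum_a c a * \prod_i v i ^+ a i) <= M.

Lemma sum_monomials_le :
  \sum_a normc (c a) * \prod_i z i ^+ a i <= (4 * expR 1) ^+ m * B ^+ m * M.
Proof.
have [w wP] := @prim_root_exists R N isT.
have N_gt2m : (2 * m < N)%N by [].
have cz_ge0 a : 0 <= normc (c a) * \prod_i z i ^+ a i.
  by rewrite mulr_ge0 ?normc_ge0// prodr_ge0// => i _; exact: exprn_ge0.
apply: (@le_trans _ _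
   (\sum_k \sum_(a | last_var m k a) normc (c a) * \prod_i z i ^+ a i)).
  rewrite (exchange_big_dep xpredT)//=; apply: ler_sum => a _.
  have [am|am] := eqVneq (degree a) m; last first.
    by rewrite c0// normc0 mul0r sumr_ge0.
  have [i0 ai0] : exists i, (0 < a i)%N.
    apply/existsP; move: m_gt0; rewrite -am; apply: contraTT => /existsPn a0.
    by rewrite -leqNgt leqn0 /degree big1// => i _; apply/eqP; rewrite -leqn0 leqNgt.
  pose k := [arg max_(i > i0 | (0 < a i)%N) (i : nat)].
  have [ak kmax] : (0 < a k)%N /\ forall j : 'I_n, (0 < a j)%N -> (j <= k)%N.
    by rewrite /k; case: arg_maxnP.
  have lk : last_var m k a.
    apply/and3P; split=> //; first exact/eqP.
    apply/forallP => j; apply/implyP => kj.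
    by rewrite -leqn0 leqNgt; apply: contraL kj => /kmax; rewrite -leqNgt.
  by rewrite [leRHS](bigD1 k)//= lerDl sumr_ge0.
set K := (2 * expR 1) ^+ m : R.
have K_ge1 : 1 <= K.
  by rewrite exprn_ege1//; have := @expR_ge1Dx R 1; lra.
(* Since [K >= 1], its square root is bounded by [K] itself. *)
have BK : Num.sqrt ((B ^+ 2) ^+ m * K) <= B ^+ m * K.
  rewrite sqrtrM ?exprn_ge0 ?sqr_ge0// -exprM mulnC exprM sqrtr_sqr.
  rewrite ger0_norm ?exprn_ge0// ler_wpM2l ?exprn_ge0//.
  have K_ge0 : 0 <= K by rewrite (le_trans ler01).
  by rewrite -[leRHS](ger0_norm K_ge0) -sqrtr_sqr ler_wsqrtr// expr2 ler_peMr.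
apply: (@le_trans _ _ (\sum_k Num.sqrt (\sum_a normc (c a * (a k)%:R) ^+ 2) * (B ^+ m * K))).
  apply: ler_sum => k _.
  apply: (@le_trans _ _ (Num.sqrt (\sum_(a | last_var m k a) normc (c a) ^+ 2) *
     Num.sqrt (\sum_(a | last_var m k a) (\prod_i z i ^+ a i) ^+ 2))).
    exact: sum_cauchy_schwarz_sqrt.
  apply: ler_pM; rewrite ?sqrtr_ge0//.
    (* [a k >= 1] for the last variable [k], so inserting this factor turns [c] into the
       coefficients of [E_k] at no cost. *)
    apply: ler_wsqrtr; rewrite [leLHS]big_mkcond; apply: ler_sum => a _.
    case: ifP => [/and3P[_ ak _]|_]; last exact: sqr_ge0.
    rewrite lerXn2r ?nnegrE ?normc_ge0// normcM normc_nat ler_peMr ?normc_ge0//.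
    by rewrite ler1n.
  apply: le_trans BK; apply: ler_wsqrtr.
  under eq_bigr => a _.
    rewrite -prodrXl; under eq_bigr do rewrite -exprM mulnC exprM.
    over.
  have z2_ge0 (i : 'I_n) : 0 <= z i ^+ 2 by exact: sqr_ge0.
  exact: (sum_last_var_le N m_gt0 y_ge0 yX (sqr_ge0 B) z2_ge0 zB).
rewrite -mulr_suml.
have := sum_partial_norms_le m_gt0 N_gt2m wP c0 cM.
have BK_ge0 : 0 <= B ^+ m * K by rewrite mulr_ge0 ?exprn_ge0// (le_trans ler01).
move=> /(ler_wpM2r BK_ge0) /le_trans; apply.
rewrite le_eqVlt; apply/orP; left; apply/eqP.
rewrite /K (_ : 4 * expR 1 = 2 * (2 * expR 1)); last by ring.
by rewrite [in RHS]exprMn; ring.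
Qed.

End finite_dimensional_bound.

(** * Monomial expansion of a multilinear form *)

Section linfty_basics.
Variable R : realType.
Implicit Types (z u v : linfty R) (f : nat -> R[i]).

Lemma linfty_bounded z : exists M, forall n, normc (z n) <= M.
Proof. by case: z => f /= /asboolP. Qed.

Lemma normc_le_linfty_norm z n : normc (z n) <= linfty_norm z.
Proof.
apply: ub_le_sup; last by exists n.
by have [M zM] := linfty_bounded z; exists M => _ [k _ <-].
Qed.

Lemma linfty_norm_le z M : (forall n, normc (z n) <= M) -> linfty_norm z <= M.
Proof.
move=> zM; apply: ge_sup; first by exists (normc (z 0)), 0.
by move=> _ [k _ <-].
Qed.

Lemma linfty_norm_ge0 z : 0 <= linfty_norm z.
Proof. exact: le_trans (normc_ge0 _) (normc_le_linfty_norm z 0). Qed.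

Lemma linftyP z u : (forall n, z n = u n) -> z = u.
Proof. by move=> zu; apply/val_inj/funext. Qed.

Lemma linftyD z u n : (z + u) n = z n + u n. Proof. by []. Qed.
Lemma linftyZ (a : R[i]) z n : (a *: z) n = a * z n. Proof. by []. Qed.
Lemma linfty0 n : (0 : linfty R) n = 0. Proof. by []. Qed.

Lemma linfty_sum (I : Type) (r : seq I) (P : pred I) (F : I -> linfty R) n :
  (\sum_(i <- r | P i) F i) n = \sum_(i <- r | P i) F i n.
Proof. exact: (big_morph (fun z => z n) (fun z u => linftyD z u n) (linfty0 n)). Qed.

Definition to_linfty f : linfty R := insubd (0 : linfty R) f.

Lemma to_linftyE f M n : (forall k, normc (f k) <= M) -> to_linfty f n = f n.
Proof.
by move=> fM; rewrite /to_linfty [linfty_seq _]val_insubd ifT//; apply/asboolP; exists M.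
Qed.

Definition basis_vec (j : nat) : linfty R := to_linfty (fun i => (i == j)%:R).

Lemma basis_vecE j n : basis_vec j n = (n == j)%:R.
Proof. by apply: (@to_linftyE _ 1) => k; case: eqP; rewrite ?normc1 ?normc0. Qed.

Lemma linfty_expand (J : seq nat) z : uniq J -> (forall j, j \notin J -> z j = 0) ->
  z = \sum_(j <- J) z j *: basis_vec j.
Proof.
move=> uJ zJ; apply: linftyP => n; rewrite linfty_sum.
rewrite (eq_bigr (fun j => z j * (n == j)%:R)); last first.
  by move=> j _; rewrite linftyZ basis_vecE.
have [nJ|nJ] := boolP (n \in J).
  rewrite (bigD1_seq n)//= eqxx mulr1 big1 ?addr0// => j jn.
  by rewrite eq_sym (negPf jn) mulr0.
rewrite zJ// big1_seq// => j /andP[_ jJ].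
by case: eqP => [nj|]; rewrite ?mulr0//; rewrite nj jJ in nJ.
Qed.

End linfty_basics.

(** * Multi-indices as classes of words *)

Fixpoint words (J : seq nat) (t : nat) : seq (seq nat) :=
  if t is t'.+1 then [seq rcons s j | s <- words J t', j <- J] else [:: [::]].

Lemma mem_words J t s : (s \in words J t) = (size s == t) && all (mem J) s.
Proof.
elim: t s => [|t IH] s /=; first by rewrite inE; case: s.
apply/allpairsP/andP => [[[s' j] /= [s't jJ ->]]|].
  by move: s't; rewrite IH size_rcons all_rcons => /andP[/eqP -> ->]; rewrite eqxx/= jJ.
case/lastP: s => [|s j]; first by case.
rewrite size_rcons all_rcons eqSS => -[st /andP[jJ sJ]].
by exists (s, j); split; rewrite // IH st.
Qed.

Lemma uniq_words J t : uniq J -> uniq (words J t).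
Proof.
move=> uJ; elim: t => [|t IH]//=; apply: allpairs_uniq => //.
by move=> [s j] [s' j'] _ _ /= /rcons_inj [-> ->].
Qed.

Definition word_exponent (s : seq nat) : multiindex :=
  [fsfun j in seq_fset tt s => count_mem j s].

Lemma word_exponentE s j : word_exponent s j = count_mem j s.
Proof.
rewrite fsfunE seq_fsetE; case: ifPn => // js.
by apply/esym/count_memPn.
Qed.

Definition word (b : multiindex) : seq nat :=
  flatten [seq nseq (b j) j | j <- finsupp b].

Lemma count_word (b : multiindex) j : count_mem j (word b) = b j.
Proof.
rewrite count_flatten sumnE -map_comp big_map.
rewrite (eq_bigr (fun i => (i == j) * b i)%N); last first.
  by move=> i _; rewrite /= count_nseq.
have [jb|jb] := boolP (j \in finsupp b).
  rewrite (bigD1_seq j) ?fset_uniq//= eqxx mul1n big1 ?addn0// => i ij.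
  by rewrite (negPf ij).
rewrite big1_seq ?fsfun_dflt// => i /andP[_ ib].
by case: eqP => [ij|//]; move: ib; rewrite ij (negPf jb).
Qed.

Lemma size_word b : size (word b) = multideg b.
Proof.
rewrite size_flatten sumnE /shape -map_comp big_map; apply: eq_bigr => i _.
by rewrite /= size_nseq.
Qed.

(** Identifies the fibres of [word_exponent] with the duplicate-free lists [permutations (word b)]
    over which [form_coef] sums. *)
Lemma perm_word s b : perm_eq s (word b) = (word_exponent s == b).
Proof.
apply/idP/eqP => [/permP sb|<-].
  by apply/fsfunP => j; rewrite word_exponentE sb count_word.
by apply/allP => j _ /=; rewrite count_word word_exponentE.
Qed.

Lemma wordK b : word_exponent (word b) = b.
Proof. by apply/eqP; rewrite -perm_word. Qed.

Lemma mem_word b j : (j \in word b) = (j \in finsupp b).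
Proof. by rewrite mem_finsupp -count_word -has_pred1 has_count lt0n. Qed.

Lemma multideg_word_exponent s : multideg (word_exponent s) = size s.
Proof. by rewrite -size_word; apply/perm_size; rewrite perm_sym perm_word. Qed.

Lemma mem_word_exponent s j : (j \in finsupp (word_exponent s)) = (j \in s).
Proof. by rewrite mem_finsupp word_exponentE -has_pred1 has_count lt0n. Qed.

Lemma monomial_word_exponent (R : realType) (z : nat -> R[i]) s :
  monomial z (word_exponent s) = \prod_(j <- s) z j.
Proof.
have ps : perm_eq s (word (word_exponent s)) by rewrite perm_word.
rewrite (perm_big _ ps).
rewrite /word big_flatten big_map; apply: eq_bigr => j _.
by rewrite big_nseq -Monoid.iteropE.
Qed.

Definition multiindices (J : seq nat) (m : nat) : seq multiindex :=
  undup [seq word_exponent s | s <- words J m].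

Lemma mem_multiindices J m b :
  (b \in multiindices J m) = (multideg b == m) && all (mem J) (finsupp b).
Proof.
rewrite mem_undup; apply/mapP/andP => [[s]|[bm bJ]].
  rewrite mem_words => /andP[/eqP sm sJ ->].
  rewrite multideg_word_exponent sm; split=> //; apply/allP => j.
  by rewrite mem_word_exponent => /(allP sJ).
exists (word b); last by rewrite wordK.
rewrite mem_words size_word bm /=; apply/allP => j; rewrite mem_word.
exact: (allP bJ).
Qed.

Section expansion.
Variables (R : realType) (m : nat) (L : ('I_m -> linfty R) -> R[i]).
Hypothesis Lmul : multilinear L.

(** [L] is not assumed symmetric, so every distinct arrangement of the variables of [b] counts
    once. *)
Definition form_coef (b : multiindex) : R[i] :=
  if multideg b == m then
    \sum_(s <- permutations (word b)) L (fun l => basis_vec R (nth 0%N s l))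
  else 0.

Lemma multilinear_sum (i : 'I_m) (x : 'I_m -> linfty R) (r : seq nat)
    (a : nat -> R[i]) (u : nat -> linfty R) :
  L [eta x with i |-> \sum_(j <- r) a j *: u j] =
  \sum_(j <- r) a j * L [eta x with i |-> u j].
Proof.
elim: r => [|j r IH]; last by rewrite !big_cons Lmul IH.
rewrite !big_nil; have := Lmul i x (-1) 0 0.
by rewrite /= scaler0 addr0 mulN1r addNr.
Qed.

(** The slots are expanded one after the other; [t] counts those already replaced by basis vectors,
    and a letter appended on the right of a word treats the next slot. *)
Lemma multilinear_words (J : seq nat) (z : linfty R) (t : nat) :
  uniq J -> (forall j, j \notin J -> z j = 0) -> (t <= m)%N ->
  L (fun=> z) = \sum_(s <- words J t) (\prod_(j <- s) z j) *
    L (fun l => if (l < t)%N then basis_vec R (nth 0%N s l) else z).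
Proof.
move=> uJ zJ; elim: t => [|t IH] tm.
  by rewrite big_seq1 big_nil mul1r.
rewrite (IH (ltnW tm)) /= big_allpairs_dep; apply: eq_big_seq => s.
rewrite mem_words => /andP[/eqP st _].
set x : 'I_m -> linfty R := (fun l : 'I_m => _).
have -> : x = [eta x with Ordinal tm |-> \sum_(j <- J) z j *: basis_vec R j].
  apply/funext => l /=; case: eqP => // ->.
  by rewrite /x ltnn; exact: linfty_expand.
rewrite multilinear_sum mulr_sumr; apply: eq_bigr => j _.
rewrite big_rcons/= mulrA; congr (_ * L _).
apply/funext => l /=; rewrite -val_eqE/= ltnS nth_rcons st /x.
by case: ltngtP.
Qed.

(** Words are grouped by exponent. [J] is any finite list containing the support: the existence of
    coefficients uses initial segments, the upper estimate coordinates sorted by the size of [z]. *)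
Lemma hpoly_expand (J : seq nat) (z : linfty R) :
  uniq J -> (forall j, j \notin J -> z j = 0) ->
  L (fun=> z) = \sum_(b <- multiindices J m) form_coef b * monomial z b.
Proof.
move=> uJ zJ; rewrite (multilinear_words uJ zJ (leqnn m)).
rewrite (eq_big_seq (fun s => \sum_(b <- multiindices J m)
   if word_exponent s == b then
     monomial z b * L (fun l => basis_vec R (nth 0%N s l)) else 0)); last first.
  move=> s sJ; rewrite (bigD1_seq (word_exponent s)) ?undup_uniq//=; last first.
    by rewrite mem_undup map_f.
  rewrite eqxx monomial_word_exponent [X in _ + X]big1 ?addr0//; last first.
    by move=> b; rewrite eq_sym => /negPf ->.
  by congr (_ * L _); apply/funext => l; rewrite ltn_ord.
rewrite exchange_big/=; apply: eq_big_seq => b.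
rewrite mem_multiindices => /andP[bm bJ].
rewrite /form_coef bm mulr_suml -big_mkcond/= -big_filter.
have pb : perm_eq [seq s <- words J m | word_exponent s == b] (permutations (word b)).
  apply: uniq_perm; rewrite ?filter_uniq ?uniq_words ?permutations_uniq//.
  move=> s; rewrite mem_filter mem_permutations perm_word.
  case: eqP => //= sb; rewrite mem_words; apply/andP; split.
    by rewrite -multideg_word_exponent sb.
  by apply/allP => j; rewrite -mem_word_exponent sb => /(allP bJ).
by rewrite (perm_big _ pb); apply: eq_bigr => s _; rewrite mulrC.
Qed.

End expansion.

(** * Absolutely convergent sums and uniqueness of coefficients *)

Lemma perm_cat_filter (T : eqType) (r q : seq T) : uniq r -> uniq q ->
  {subset r <= q} -> perm_eq q (r ++ [seq i <- q | i \notin r]).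
Proof.
move=> ur uq rq; apply: uniq_perm => //.
  rewrite cat_uniq ur filter_uniq// andbT; apply/hasPn => i.
  by rewrite mem_filter => /andP[].
move=> i; rewrite mem_cat mem_filter.
by case: (boolP (i \in r)) => //= /rq ->.
Qed.

Section absolute_sums.
Variables (R : realType) (I : choiceType) (A : set I).
Implicit Types (f : I -> R[i]) (s : R[i]) (F G : {fset I}) (r : seq I).

Lemma esum_normc_le f (K : R) :
  (forall r, uniq r -> (forall i, i \in r -> A i) ->
     \sum_(i <- r) normc (f i) <= K) ->
  (\esum_(i in A) (normc (f i))%:E <= K%:E)%E.
Proof.
move=> fK; apply: ge_ereal_sup => _ [X [finX XA] <-].
rewrite fsbig_finite// sumEFin lee_fin fK ?fset_uniq// => i.
by rewrite in_fset_set// inE => /XA.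
Qed.

Lemma le_esum_normc f r : uniq r -> (forall i, i \in r -> A i) ->
  ((\sum_(i <- r) normc (f i))%:E <= \esum_(i in A) (normc (f i))%:E)%E.
Proof.
move=> ur rA; apply: ereal_sup_ubound; exists [set` r]; first by split.
by rewrite -fsbig_seq// sumEFin.
Qed.

Lemma cvg_totally0 (g : {fset I} -> R) :
  (g @ summability.totally --> (0 : R)) <->
  (forall e, 0 < e -> exists F, forall G, (F `<=` G)%fset -> `|g G| <= e).
Proof.
have ff := @summability.totally_filter I.
rewrite cvgr0Pnorm_le; split=> h e e0; have := h e e0.
  by move=> [F _ FG]; exists F.
by move=> [F FG]; exists F.
Qed.

Lemma esum_normc_tail f : (\esum_(i in A) (normc (f i))%:E < +oo)%E ->
  forall e, 0 < e -> exists F, forall r, uniq r ->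
    (forall i, i \in r -> A i /\ i \notin F) -> \sum_(i <- r) normc (f i) <= e.
Proof.
move=> foo e e0; set S := esum _ _ in foo.
have S0 : (0 <= S)%E by apply: esum_ge0 => i _; rewrite lee_fin normc_ge0.
have Sfin : S \is a fin_num by rewrite ge0_fin_numE.
have [_ [X [finX XA] <-]] := ub_ereal_sup_adherent e0 Sfin.
move=> SX; have {}SX : (S - e%:E < _)%E := SX.
exists (fset_set X) => r ur rAX.
have : ((\sum_(i <- fset_set X ++ r) normc (f i))%:E <= S)%E.
  apply: le_esum_normc.
    rewrite cat_uniq fset_uniq ur andbT; apply/hasPn => i /rAX[_] /=.
    by [].
  by move=> i; rewrite mem_cat in_fset_set// => /orP[/set_mem/XA//|/rAX[]].
move: SX; rewrite fsbig_finite// sumEFin -(fineK Sfin) -EFinB lte_fin lee_fin.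
by rewrite big_cat/=; lra.
Qed.

Lemma big_subset_zero (V : nmodType) (f : I -> V) r q :
  uniq r -> uniq q -> {subset r <= q} ->
  (forall i, i \in q -> i \notin r -> f i = 0) ->
  \sum_(i <- q) f i = \sum_(i <- r) f i.
Proof.
move=> ur uq rq f0; rewrite (perm_big _ (perm_cat_filter ur uq rq)) big_cat/=.
rewrite [X in _ + X]big1_seq ?addr0// => i /=.
by rewrite mem_filter => /andP[ir iq]; exact: f0.
Qed.

Lemma ler_sum_normc_subset f r q :
  uniq r -> uniq q -> {subset r <= q} ->
  \sum_(i <- r) normc (f i) <= \sum_(i <- q) normc (f i).
Proof.
move=> ur uq rq; rewrite (perm_big _ (perm_cat_filter ur uq rq)) big_cat/=.
by rewrite lerDl sumr_ge0// => i _; exact: normc_ge0.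
Qed.

Lemma abs_sums_to_finite f r : uniq r -> (forall i, i \in r -> A i) ->
  (forall i, A i -> i \notin r -> f i = 0) ->
  abs_sums_to A f (\sum_(i <- r) f i).
Proof.
move=> ur rA f0; split.
  apply: (@le_lt_trans _ _ (\sum_(i <- r) normc (f i))%:E); last exact: ltry.
  apply: esum_normc_le => q uq qA.
  have -> : \sum_(i <- q) normc (f i) = \sum_(i <- [seq i <- q | i \in r]) normc (f i).
    apply: big_subset_zero; rewrite ?filter_uniq//; first exact: mem_subseq (filter_subseq _ _).
    by move=> i iq; rewrite mem_filter iq andbT => ir; rewrite f0 ?normc0//; exact: qA.
  apply: ler_sum_normc_subset; rewrite ?filter_uniq//.
  by move=> i; rewrite mem_filter => /andP[].
apply/cvg_totally0 => e e0; exists (seq_fset tt r) => G rG.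
rewrite [X in normc (X - _)](_ : _ = \sum_(i <- r) f i); last first.
  rewrite -big_filter; apply: big_subset_zero; rewrite ?filter_uniq ?fset_uniq//.
    move=> i ir; rewrite mem_filter; apply/andP; split; first exact/mem_set/rA.
    by apply: (fsubsetP rG); rewrite seq_fsetE.
  by move=> i; rewrite mem_filter => /andP[/set_mem iA _]; exact: f0.
by rewrite subrr normc0 normr0 ltW.
Qed.

(** Absolute summability makes the partial sums Cauchy along finite sets, so it suffices to find
    good sets cofinally; truncations of [z] will provide them. *)
Lemma abs_sums_to_frequently f s :
  (\esum_(i in A) (normc (f i))%:E < +oo)%E ->
  (forall e F, 0 < e -> exists2 G, (F `<=` G)%fset &
     normc (\sum_(i <- G | i \in A) f i - s) <= e) ->
  abs_sums_to A f s.
Proof.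
move=> foo fs; split=> //; apply/cvg_totally0 => e e0.
have e30 : 0 < e / 3 by rewrite divr_gt0.
have [F Ftail] := esum_normc_tail foo e30; exists F => G FG.
have [H GH Hs] := fs _ G e30.
rewrite ger0_norm ?normc_ge0//.
have tail (r q : seq I) : uniq r -> uniq q -> {subset r <= q} ->
    {subset F <= r} ->
    normc (\sum_(i <- q | i \in A) f i - \sum_(i <- r | i \in A) f i) <= e / 3.
  move=> ur uq rq Fr.
  rewrite (perm_big _ (perm_cat_filter ur uq rq)) big_cat/= [X in X - _]addrC addrK.
  rewrite -big_filter; apply: (le_trans (normc_sum _ _ _)).
  apply: Ftail; rewrite ?filter_uniq// => i.
  rewrite !mem_filter => /and3P[/set_mem iA ir _]; split=> //.
  by apply: contra ir => /Fr.
have {}tail := tail G H (fset_uniq _) (fset_uniq _) (fsubsetP GH) (fsubsetP FG).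
set a := \sum_(i <- G | _) _ in tail *; set b := \sum_(i <- H | _) _ in tail Hs.
have -> : a - s = - (b - a) + (b - s) by ring.
apply: (le_trans (le_normcD _ _)); rewrite normcN; lra.
Qed.

Lemma abs_sums_to_partial f s : abs_sums_to A f s ->
  forall e, 0 < e -> exists F, forall G, (F `<=` G)%fset ->
    normc (\sum_(i <- G | i \in A) f i - s) <= e.
Proof.
move=> [_ /cvg_totally0 h] e /h[F FG]; exists F => G /FG.
by rewrite ger0_norm ?normc_ge0.
Qed.

End absolute_sums.

Section monomial_coefficients.
Variable R : realType.
Implicit Types (P : linfty R -> R[i]) (c : multiindex -> R[i]).

Lemma supported_belowP (b : multiindex) k :
  supported_below 0%N k b <-> (forall j, j \in finsupp b -> (j < k)%N).
Proof.
split=> [bk j|bk j kj].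
  by rewrite mem_finsupp ltnNge; apply: contra => /bk ->.
by apply/eqP; apply: contraTT kj; rewrite -mem_finsupp -ltnNge => /bk.
Qed.

Lemma supported_below_multiindices k m (b : multiindex) :
  b \in multiindices (iota 0 k) m -> supported_below 0%N k b.
Proof.
rewrite mem_multiindices => /andP[_ /allP bk]; apply/supported_belowP => j /bk.
by rewrite /= mem_iota add0n.
Qed.

Lemma is_monomial_coefs_form m (L : ('I_m -> linfty R) -> R[i]) :
  multilinear L -> is_monomial_coefs (fun z => L (fun=> z)) (form_coef L).
Proof.
move=> Lmul k z zk.
rewrite (@hpoly_expand _ _ _ Lmul (iota 0 k)) ?iota_uniq//; last first.
  by move=> j; rewrite mem_iota add0n -leqNgt => /zk.
apply: abs_sums_to_finite; rewrite ?undup_uniq//.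
  by move=> b; exact: supported_below_multiindices.
move=> b /supported_belowP bk; rewrite mem_multiindices negb_and.
case/orP => [bm|/allPn[j jb]].
  by rewrite /form_coef (negPf bm) mul0r.
by rewrite /= mem_iota add0n bk.
Qed.

Definition torus_point k N (w : R[i]) (t : 'I_k -> 'I_N) : linfty R :=
  to_linfty (fun j => if insub j is Some i then w ^+ t i else 0).

Lemma prod_supported_below k (b : multiindex) (f : nat -> R[i]) :
  (forall j, j \in finsupp b -> (j < k)%N) ->
  \prod_(j <- finsupp b) f j ^+ b j = \prod_(i < k) f i ^+ b i.
Proof.
move=> bk; rewrite -(big_mkord xpredT (fun j => f j ^+ b j)).
rewrite (perm_big _ (perm_cat_filter (fset_uniq (finsupp b)) (iota_uniq 0 (k - 0)) _)); last first.
  by move=> j jb; rewrite mem_iota subn0 bk.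
rewrite big_cat/= [X in _ * X]big1_seq ?mulr1// => j /=.
by rewrite mem_filter => /andP[jb _]; rewrite fsfun_dflt// expr0.
Qed.

Lemma torus_pointE k N (w : R[i]) (t : 'I_k -> 'I_N) (i : 'I_k) :
  normc w = 1 -> torus_point w t i = w ^+ t i.
Proof.
move=> w1; rewrite /torus_point (@to_linftyE _ _ 1); first by rewrite valK.
by move=> j; case: insubP => [? _ _|_]; rewrite ?normc0// normcX w1 expr1n.
Qed.

Lemma torus_point_supported k N (w : R[i]) (t : 'I_k -> 'I_N) :
  normc w = 1 -> supported_below 0 k (torus_point w t).
Proof.
move=> w1 j kj; rewrite /torus_point (@to_linftyE _ _ 1).
  by rewrite insubF// ltnNge kj.
by move=> i; case: insubP => [? _ _|_]; rewrite ?normc0// normcX w1 expr1n.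
Qed.

Lemma monomial_torus_point k N (w : R[i]) (t : 'I_k -> 'I_N) (b : multiindex) :
  normc w = 1 -> supported_below 0%N k b ->
  monomial (torus_point w t) b = character w (fun i => b i) t.
Proof.
move=> w1 /supported_belowP bk; rewrite /monomial (prod_supported_below _ bk).
by apply: eq_bigr => i _; rewrite torus_pointE.
Qed.

Lemma le_multideg (b : multiindex) j : (b j <= multideg b)%N.
Proof.
have [jb|/fsfun_dflt -> //] := boolP (j \in finsupp b).
by rewrite /multideg (bigD1_seq j) ?fset_uniq//= leq_addr.
Qed.

(** At the point with [k] ones, the torus point for [N = 1], every such monomial has modulus 1, so
    convergence there is summability of the coefficients. *)
Lemma summable_monomial_coefs P c k : is_monomial_coefs P c ->
  (\esum_(b in [set b : multiindex | supported_below 0%N k b])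
     (normc (c b))%:E < +oo)%E.
Proof.
move=> Pc; have n1 : normc (1 : R[i]) = 1 by exact: normc1.
have [+ _] := Pc k _ (torus_point_supported (fun=> ord0 : 'I_1) n1).
congr (_ < _)%E; apply: eq_esum => b bk.
rewrite normcM monomial_torus_point// normc_prod big1 ?mulr1// => i _.
by rewrite !normcX normc1 !expr1n.
Qed.

(* Averaging [P] against the inverse of a monomial over a discrete torus
   returns the sum of the coefficients whose index is congruent modulo [N] to
   that of the monomial. *)
Lemma monomial_coef_average P c k (a : multiindex) (e : R) :
  is_monomial_coefs P c -> supported_below 0%N k a -> 0 < e ->
  exists N0, forall N (w : R[i]), (N0 < N)%N -> N.-primitive_root w ->
    normc (c a - (\sum_(t : {ffun 'I_k -> 'I_N})
       P (torus_point w t) / character w (fun i => a i) t) / (N ^ k)%:R) <= e.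
Proof.
move=> Pc ak e0; pose D := [set b : multiindex | supported_below 0%N k b].
have e2 : 0 < e / 2 by rewrite divr_gt0.
have [F Ftail] := esum_normc_tail (summable_monomial_coefs k Pc) e2.
(* Beyond this bound no exponent of [a] or of a member of [F] wraps around, so an index congruent to
   [a] but different from it lies outside [F], where the tail is at most [e / 2]. *)
exists (multideg a + \sum_(b <- F) multideg b)%N => N w N0N wP.
have N_gt0 : (0 < N)%N by exact: leq_ltn_trans N0N.
have w1 : normc w = 1 := normc_unity N_gt0 (prim_expr_order wP).
(* Each point of the torus needs its own finite set; the torus being finite, one [G] contains them
   all. *)
have /choice[H HP] : forall t : {ffun 'I_k -> 'I_N}, exists F', forall G, (F' `<=` G)%fset ->
    normc (\sum_(b <- G | b \in D) c b * monomial (torus_point w t) b -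
           P (torus_point w t)) <= e / 2.
  by move=> t; exact: abs_sums_to_partial (Pc k _ (torus_point_supported t w1)) _ e2.
pose G := (a |` (F `|` \big[fsetU/fset0]_(t : {ffun 'I_k -> 'I_N}) H t))%fset.
have HG t : (H t `<=` G)%fset.
  apply: fsubset_trans (fsubsetU1 _ _); apply: fsubset_trans (fsubsetUr _ _).
  exact: bigfcup_sup.
have aG : a \in G by rewrite !inE eqxx.
have aD : a \in D by exact/mem_set.
pose T : R[i] := (N ^ k)%:R.
have T0 : T != 0 by rewrite pnatr_eq0 expn_eq0 negb_and -lt0n N_gt0.
pose p (t : {ffun 'I_k -> 'I_N}) :=
  \sum_(b <- G | b \in D) c b * monomial (torus_point w t) b.
pose chi (b : multiindex) (t : {ffun 'I_k -> 'I_N}) := character w (fun i => b i) t.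
pose cong (b : multiindex) := [forall i : 'I_k, b i == a i %[mod N]].
have pE : (\sum_t p t / chi a t) / T =
    c a + \sum_(b <- G | [&& b \in D, b != a & cong b]) c b.
  rewrite (eq_bigr (fun t => \sum_(b <- G | b \in D) c b * (chi b t / chi a t))); last first.
    move=> t _; rewrite /p mulr_suml; apply: eq_bigr => b bD.
    by rewrite monomial_torus_point ?mulrA//; exact/set_mem.
  rewrite exchange_big/= mulr_suml.
  rewrite (eq_bigr (fun b => if cong b then c b else 0)); last first.
    move=> b _; rewrite -mulr_sumr character_orthogonal// -/(cong b).
    by case: ifP => _; rewrite ?mulr0 ?mul0r// mulfK.
  rewrite big_mkcond (bigD1_seq a) ?fset_uniq//= aD ifT; last by apply/forallP.
  congr (_ + _); rewrite big_mkcond [RHS]big_mkcond/=; apply: eq_bigr => b _.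
  by case: (b \in D); case: (b != a).
rewrite (_ : c a - _ = - \sum_(b <- G | [&& b \in D, b != a & cong b]) c b +
   (\sum_t (p t - P (torus_point w t)) / chi a t) / T); last first.
  under [X in _ = _ + X / _]eq_bigr do rewrite mulrBl.
  by rewrite sumrB mulrBl pE; ring.
rewrite [e](splitr e); apply: (le_trans (le_normcD _ _)); apply: lerD.
  rewrite normcN -big_filter; apply: (le_trans (normc_sum _ _ _)).
  apply: Ftail; first by rewrite filter_uniq ?fset_uniq.
  move=> b; rewrite mem_filter => /andP[/and3P[/set_mem bD ba /forallP ab] _].
  split=> //; apply: contra ba => bF; apply/eqP/fsfunP => j.
  have [jk|kj] := ltnP j k; last by rewrite ak// bD.
  have := ab (Ordinal jk); rewrite /= !modn_small; first by move/eqP.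
    apply: leq_ltn_trans N0N; apply: leq_trans (le_multideg _ _) _.
    exact: leq_addr.
  apply: leq_ltn_trans N0N; apply: leq_trans (le_multideg _ j) _.
  by rewrite (bigD1_seq b) ?fset_uniq//= addnCA leq_addr.
rewrite normcM normcV normc_nat ler_pdivrMr ?ltr0n ?expn_gt0 ?N_gt0//.
apply: (le_trans (normc_sum _ _ _)).
apply: (@le_trans _ _ (\sum_(t : {ffun 'I_k -> 'I_N}) (e / 2))).
  apply: ler_sum => t _; rewrite normcM normcV normc_character// invr1 mulr1.
  exact: HP.
by rewrite sumr_const card_ffun !card_ord mulr_natr.
Qed.

(** Both coefficients are within [e / 2] of the same average, which depends on [P] only. *)
Lemma is_monomial_coefs_unique P c c' :
  is_monomial_coefs P c -> is_monomial_coefs P c' -> c = c'.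
Proof.
move=> Pc Pc'; apply/funext => a.
have [k ak] : exists k, supported_below 0%N k a.
  exists (\max_(j <- finsupp a) j.+1)%N; apply/supported_belowP => j ja.
  exact: (@leq_bigmax_seq _ _ xpredT S j ja isT).
apply/eqP; rewrite -subr_eq0 -normc_eq0; apply/eqP/le_anti.
rewrite normc_ge0 andbT; apply/ler_addgt0Pr => e e0; rewrite add0r.
have e2 : 0 < e / 2 by rewrite divr_gt0.
have [N0 h0] := monomial_coef_average Pc ak e2.
have [N1 h1] := monomial_coef_average Pc' ak e2.
have [w wP] := @prim_root_exists R (N0 + N1).+1 isT.
have := h0 _ w _ wP; have := h1 _ w _ wP; set z := _ / (_ ^ k)%:R => h h'.
have -> : c a - c' a = (c a - z) + - (c' a - z) by ring.
apply: (le_trans (le_normcD _ _)); rewrite normcN.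
by have := h ltac:(lia); have := h' ltac:(lia); lra.
Qed.

Lemma monomial_coefE m (L : ('I_m -> linfty R) -> R[i]) :
  multilinear L -> monomial_coef (fun z => L (fun=> z)) = form_coef L.
Proof.
move=> Lmul; apply: is_monomial_coefs_unique (is_monomial_coefs_form Lmul).
by have := xgetPex (fun=> 0) (ex_intro _ _ (is_monomial_coefs_form Lmul)).
Qed.

End monomial_coefficients.

(** * Decreasing rearrangement and continuity *)

Section reindexing.
Variables (N m : nat) (J : seq nat).
Hypotheses (uJ : uniq J) (mN : (m < N)%N).
Let n := size J.
Implicit Types (a : {ffun 'I_n -> 'I_N}).

Definition lift_exponent a : multiindex :=
  word_exponent (flatten [seq nseq (a i) (nth 0%N J i) | i <- enum 'I_n]).

Lemma lift_exponentE a j :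
  lift_exponent a j = (\sum_(i < n) (nth 0 J i == j) * a i)%N.
Proof.
rewrite word_exponentE count_flatten sumnE -map_comp big_map big_enum/=.
by apply: eq_bigr => i _; rewrite count_nseq.
Qed.

Lemma lift_exponent_nth a (i : 'I_n) : lift_exponent a (nth 0%N J i) = a i.
Proof.
rewrite lift_exponentE (bigD1 i)//= eqxx mul1n big1 ?addn0// => k ki.
by rewrite nth_uniq// -[_ == _ :> nat]/(k == i) (negPf ki).
Qed.

Lemma lift_exponent_out a j : j \notin J -> lift_exponent a j = 0%N.
Proof.
move=> jJ; rewrite lift_exponentE big1// => i _; case: eqP => // ij.
by rewrite -ij mem_nth in jJ.
Qed.

Lemma multideg_lift a : multideg (lift_exponent a) = degree a.
Proof.
rewrite multideg_word_exponent size_flatten sumnE /shape -map_comp big_map big_enum/=.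
by apply: eq_bigr => i _; rewrite size_nseq.
Qed.

Lemma monomial_lift (R : realType) (z : nat -> R[i]) a :
  monomial z (lift_exponent a) = \prod_(i < n) z (nth 0%N J i) ^+ a i.
Proof.
rewrite monomial_word_exponent big_flatten big_map big_enum/=; apply: eq_bigr => i _.
by rewrite big_nseq -Monoid.iteropE.
Qed.

(** No exponent exceeds the degree [m < N], so exponents in ['I_N] lose nothing. This carries sums
    over multi-indices to the setting of the finite-dimensional estimate. *)
Lemma sum_multiindices (V : nmodType) (F : multiindex -> V) :
  \sum_(b <- multiindices J m) F b =
  \sum_(a : {ffun 'I_n -> 'I_N} | degree a == m) F (lift_exponent a).
Proof.
have -> : \sum_(a : {ffun 'I_n -> 'I_N} | degree a == m) F (lift_exponent a) =
    \sum_(b <- [seq lift_exponent a | a <- enum [pred a | degree a == m]]) F b.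
  by rewrite big_map big_enum.
apply/perm_big/uniq_perm; rewrite ?undup_uniq//.
  rewrite map_inj_uniq ?enum_uniq// => a a' aa'; apply/ffunP => i.
  by apply/val_inj; rewrite /= -!lift_exponent_nth aa'.
move=> b; apply/idP/mapP => [|[a]]; last first.
  rewrite mem_enum inE => am ->; rewrite mem_multiindices multideg_lift am/=.
  apply/allP => j; rewrite mem_finsupp /=; apply: contraR => jJ.
  by rewrite lift_exponent_out.
rewrite mem_multiindices => /andP[/eqP bm /allP bJ].
have bN j : (b j < N)%N by apply: leq_ltn_trans mN; rewrite -bm le_multideg.
pose a : {ffun 'I_n -> 'I_N} := [ffun i : 'I_n => Ordinal (bN (nth 0%N J i))].
have ab : lift_exponent a = b.
  apply/fsfunP => j; have [jJ|jJ] := boolP (j \in J).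
    have jn : (index j J < n)%N by rewrite index_mem.
    by have := lift_exponent_nth a (Ordinal jn); rewrite ffunE/= nth_index.
  rewrite lift_exponent_out// fsfun_dflt//.
  by apply: contra jJ => /bJ.
by exists a; rewrite ?ab// mem_enum inE -multideg_lift ab bm.
Qed.

End reindexing.

Section rearrangement.
Variables (R : realType) (z : linfty R).

Lemma tail_sup_has_sup (A : set nat) : A !=set0 ->
  has_sup [set normc (z j) | j in A].
Proof.
move=> [j Aj]; split; first by exists (normc (z j)), j.
by exists (linfty_norm z) => _ [k _ <-]; exact: normc_le_linfty_norm.
Qed.

Lemma cofinite_nonempty (F : {fset nat}) : (~` [set` F]) !=set0.
Proof.
exists (\max_(j <- F) j.+1)%N => /= jF.
by have := @leq_bigmax_seq _ _ xpredT S _ jF isT; rewrite ltnn.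
Qed.

Lemma decr_rearr_lower n : (0 < n)%N ->
  has_inf [set sup [set normc (z j) | j in ~` [set` F]]
      | F in [set F : {fset nat} | (#|` F| < n)%N]].
Proof.
move=> n0; split; first by eexists; exists fset0 => //=; rewrite cardfs0.
exists 0 => _ [F _ <-]; have [j jF] := cofinite_nonempty F.
apply: (le_trans (normc_ge0 (z j))); apply: ub_le_sup; last by exists j.
by case: (tail_sup_has_sup (cofinite_nonempty F)).
Qed.

(** A set [F] with at most [i] elements misses one of the first [i + 1] entries of [J], where [|z|]
    is at least its value at entry [i]. Only a finite part of [z] is sorted, whence an
    inequality. *)
Lemma le_decr_rearr (J : seq nat) (i : nat) : uniq J -> (i < size J)%N ->
  sorted (fun j k => normc (z k) <= normc (z j)) J ->
  normc (z (nth 0%N J i)) <= decr_rearr z i.+1.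
Proof.
move=> uJ iJ sJ; apply: lb_le_inf; first by case: (decr_rearr_lower (ltn0Sn i)).
move=> _ [F /= Fi <-].
have [k ki kF] : exists2 k, (k <= i)%N & nth 0%N J k \notin F.
  have : ~~ all (mem F) (take i.+1 J).
    apply: contraL Fi => /allP JF; rewrite -leqNgt.
    have -> : i.+1 = size (take i.+1 J) by rewrite size_takel.
    by apply: uniq_leq_size => //; exact: take_uniq.
  case/allPn => j /(nthP 0%N)[k]; rewrite size_takel// => ki <- kF.
  by exists k => //; move: kF; rewrite nth_take.
apply: (@le_trans _ _ (normc (z (nth 0%N J k)))).
  apply: (sorted_leq_nth _ _ _ sJ) => //.
  - by move=> a b c /= ab bc; exact: le_trans ab.
  - exact: leq_ltn_trans ki iJ.
apply: ub_le_sup; last by exists (nth 0%N J k) => //=; exact/negP.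
by case: (tail_sup_has_sup (cofinite_nonempty F)).
Qed.

Lemma decr_rearr_le_weak (q : R) n : (0 < n)%N -> (weak_norm q z < +oo)%E ->
  decr_rearr z n * n%:R `^ q^-1 <= fine (weak_norm q z).
Proof.
move=> n0 zq; have le1 k : (0 < k)%N -> ((decr_rearr z k * k%:R `^ q^-1)%:E <= weak_norm q z)%E.
  by move=> k0; apply: ereal_sup_ubound; exists k.
rewrite -lee_fin fineK ?le1// fin_numElt zq andbT.
exact: lt_le_trans (ltNyr _) (le1 1%N _).
Qed.

Lemma decr_rearr_ge0 n : (0 < n)%N -> 0 <= decr_rearr z n.
Proof.
move=> n0; apply: lb_le_inf; first by case: (decr_rearr_lower n0).
move=> _ [F _ <-]; have [j jF] := cofinite_nonempty F.
apply: (le_trans (normc_ge0 (z j))); apply: ub_le_sup; last by exists j.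
by case: (tail_sup_has_sup (cofinite_nonempty F)).
Qed.

(** The weak space sits inside [c_0]: once [n^(1/q) > B / e], fewer than [n] coordinates exceed
    [e]. *)
Lemma weak_tail_small (q : R) e : 0 < q -> (weak_norm q z < +oo)%E -> 0 < e ->
  exists k, forall j, (k <= j)%N -> normc (z j) <= e.
Proof.
move=> q0 zq e0; set B := fine (weak_norm q z).
have B0 : 0 <= B.
  apply: le_trans (decr_rearr_le_weak (ltn0Sn 0) zq).
  by rewrite mulr_ge0 ?decr_rearr_ge0 ?powR_ge0.
pose n := (Num.truncn ((B / e) `^ q)).+1.
have Bn : B / e < n%:R `^ q^-1.
  have -> : B / e = ((B / e) `^ q) `^ q^-1.
    by rewrite -powRrM mulfV ?gt_eqF// powRr1// divr_ge0// ltW.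
  by apply: gt0_ltr_powR; rewrite ?invr_gt0 ?nnegrE ?powR_ge0// truncnS_gt.
have dn : decr_rearr z n < e.
  have := decr_rearr_le_weak (ltn0Sn _ : (0 < n)%N) zq; rewrite -/B => zB.
  have n1 : 0 < n%:R `^ q^-1 by apply: le_lt_trans Bn; rewrite divr_ge0// ltW.
  rewrite -(ltr_pM2r n1); apply: le_lt_trans zB _.
  by rewrite mulrC -ltr_pdivrMr.
have [_ [F _ <-] Fe] := inf_lt (decr_rearr_lower (ltn0Sn _ : (0 < n)%N)).1 dn.
exists (\max_(j <- F) j.+1)%N => j Fj; apply: ltW; apply: le_lt_trans Fe.
apply: ub_le_sup; first by case: (tail_sup_has_sup (cofinite_nonempty F)).
exists j => //= jF; move: Fj; rewrite leqNgt => /negP; apply.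
exact: (@leq_bigmax_seq _ _ xpredT S _ jF isT).
Qed.

End rearrangement.

Section continuity.
Variables (R : realType) (m : nat) (L : ('I_m -> linfty R) -> R[i]).
Hypotheses (Lmul : multilinear L) (Lbd : bounded_form L).

Lemma multilinearB (i : 'I_m) (x : 'I_m -> linfty R) (u v : linfty R) :
  L [eta x with i |-> u - v] = L [eta x with i |-> u] - L [eta x with i |-> v].
Proof.
have -> : u - v = (-1) *: v + u by rewrite scaleN1r addrC.
by rewrite Lmul mulN1r addrC.
Qed.

Lemma form_bound : exists2 K, 0 <= K &
  forall x, normc (L x) <= K * \prod_(i < m) linfty_norm (x i).
Proof.
have [K LK] := Lbd; exists `|K| => // x; apply: (le_trans (LK x)).
rewrite ler_wpM2r ?ler_norm// prodr_ge0// => i _; exact: linfty_norm_ge0.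
Qed.

(** The arguments are switched from [v] to [u] one slot at a time, and each of the [m] steps costs
    [K A'^(m-1)] times the norm of [u - v]. *)
Lemma poly_lipschitz (A : R) : exists2 K, 0 <= K & forall u v : linfty R,
  linfty_norm u <= A -> linfty_norm v <= A ->
  normc (L (fun=> u) - L (fun=> v)) <= K * linfty_norm (u - v).
Proof.
have [K K0 LK] := form_bound; pose A' := Num.max A 0.
have A'0 : 0 <= A' by rewrite le_max lexx orbT.
exists (m%:R * (K * A' ^+ m.-1)) => [|u v uA vA].
  by rewrite !mulr_ge0// exprn_ge0.
have {}uA : linfty_norm u <= A' by rewrite le_max uA.
have {}vA : linfty_norm v <= A' by rewrite le_max vA.
pose x t (l : 'I_m) := if (l < t)%N then u else v.
have step t : (t < m)%N ->
    normc (L (x t.+1) - L (x t)) <= K * A' ^+ m.-1 * linfty_norm (u - v).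
  move=> tm; pose i := Ordinal tm.
  have -> : x t.+1 = [eta x t with i |-> u].
    by apply/funext => l /=; rewrite /x -val_eqE/= ltnS; case: ltngtP.
  have -> : L (x t) = L [eta x t with i |-> v].
    congr L; apply/funext => l /=; rewrite /x -val_eqE/=.
    by case: eqP => // ->; rewrite ltnn.
  rewrite -multilinearB; apply: (le_trans (LK _)).
  rewrite -mulrA ler_wpM2l// (bigD1 i)//= eqxx mulrC.
  rewrite ler_wpM2r ?linfty_norm_ge0//.
  apply: (@le_trans _ _ (\prod_(l < m | l != i) A')).
    apply: ler_prod => l /negPf ->; rewrite linfty_norm_ge0 /x.
    by case: ifP.
  by rewrite prodr_const cardC1 card_ord.
have main t : (t <= m)%N ->
    normc (L (x t) - L (x 0%N)) <= t%:R * (K * A' ^+ m.-1 * linfty_norm (u - v)).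
  elim: t => [|t IH] tm; first by rewrite subrr normc0 mul0r.
  have -> : L (x t.+1) - L (x 0%N) = (L (x t.+1) - L (x t)) + (L (x t) - L (x 0%N)).
    by ring.
  apply: (le_trans (le_normcD _ _)).
  rewrite -natr1 mulrDl mul1r addrC lerD ?step ?IH//.
  exact: ltnW.
have := main m (leqnn m); rewrite !mulrA; congr (normc (L _ - L _) <= _).
by apply/funext => l; rewrite /x ltn_ord.
Qed.

Lemma normc_le_poly_norm (P : linfty R -> R[i]) z :
  P = (fun z => L (fun=> z)) -> linfty_norm z < 1 ->
  normc (P z) <= poly_norm P.
Proof.
move=> PE z1; apply: ub_le_sup; last by exists z.
have [K K0 LK] := form_bound; exists K => _ [u /= u1 <-].
rewrite PE; apply: (le_trans (LK _)).
rewrite ler_piMr// prodr_const exprn_ile1 ?linfty_norm_ge0//; exact: ltW.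
Qed.

(** [poly_norm] sees only the open unit ball, so a point of norm 2 is shrunk by 4 rather than by 2;
    homogeneity, read off the finite expansion, returns [4^m]. *)
Lemma normc_poly_le (J : seq nat) (z : linfty R) : uniq J ->
  (forall j, j \notin J -> z j = 0) -> linfty_norm z <= 2 ->
  normc (L (fun=> z)) <= 4 ^+ m * poly_norm (fun z => L (fun=> z)).
Proof.
move=> uJ zJ z2; pose u := (4^-1 : R[i]) *: z.
have uE j : u j = 4^-1 * z j by [].
have uJ0 j : j \notin J -> u j = 0 by move=> /zJ zj; rewrite uE zj mulr0.
have -> : L (fun=> z) = 4 ^+ m * L (fun=> u).
  rewrite !(hpoly_expand Lmul uJ)// mulr_sumr; apply: eq_big_seq => b.
  rewrite mem_multiindices => /andP[/eqP bm _].
  rewrite mulrCA; congr (_ * _).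
  rewrite /monomial -bm /multideg expr_sum -big_split; apply: eq_bigr => j _.
  rewrite -[RHS]/(4 ^+ b j * u j ^+ b j).
  by rewrite -exprMn uE mulrA divff ?mul1r// pnatr_eq0.
rewrite normcM normcX normc_nat ler_wpM2l ?exprn_ge0//.
apply: (@normc_le_poly_norm _ u) => //.
have : linfty_norm u <= 4^-1 * 2.
  apply: linfty_norm_le => n; rewrite uE normcM normcV normc_nat.
  by rewrite ler_wpM2l ?invr_ge0// (le_trans (normc_le_linfty_norm _ _)).
by move=> /le_lt_trans; apply; lra.
Qed.

End continuity.

(** * The upper estimate *)

Section upper_inclusion.
Variables (R : realType) (m : nat) (L : ('I_m -> linfty R) -> R[i]) (z : linfty R).
Hypotheses (m_gt1 : (2 <= m)%N) (Lmul : multilinear L) (Lbd : bounded_form L).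
Let q : R := (2 * m)%:R / (m.-1)%:R.
Hypothesis zq : (weak_norm q z < +oo)%E.
Let P : linfty R -> R[i] := fun z => L (fun=> z).
Let B : R := fine (weak_norm q z).

Let m_gt0 : (0 < m)%N. Proof. exact: ltnW. Qed.

Let q_gt0 : 0 < q.
Proof. by rewrite divr_gt0 ?ltr0n ?muln_gt0 ?m_gt0//; case: m m_gt1 => [|[|]]. Qed.

Let B_ge0 : 0 <= B.
Proof.
apply: le_trans (decr_rearr_le_weak (ltn0Sn 0) zq).
by rewrite mulr_ge0 ?decr_rearr_ge0 ?powR_ge0.
Qed.

(** [2 / q = (m - 1) / m], so squaring the weak bound produces the powers of [y j = j^(1/m)] that
    the finite-dimensional estimate expects. *)
Lemma sorted_sqr_le (J : seq nat) (i : nat) : uniq J -> (i < size J)%N ->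
  sorted (fun j k => normc (z k) <= normc (z j)) J ->
  normc (z (nth 0%N J i)) ^+ 2 <= B ^+ 2 / (i.+1%:R `^ m%:R^-1) ^+ m.-1.
Proof.
move=> uJ iJ sJ; have x_gt0 : 0 < i.+1%:R :> R by rewrite ltr0n.
have -> : (i.+1%:R `^ m%:R^-1) ^+ m.-1 = (i.+1%:R `^ q^-1) ^+ 2 :> R.
  rewrite -!powR_mulrn ?powR_ge0// -!powRrM; congr (_ `^ _).
  rewrite /q natrM; field.
  by rewrite !pnatr_eq0; case: m m_gt1 => [|[|]].
rewrite ler_pdivlMr ?exprn_gt0 ?powR_gt0// -exprMn.
rewrite lerXn2r ?nnegrE ?mulr_ge0 ?normc_ge0 ?powR_ge0//.
apply: le_trans (decr_rearr_le_weak (ltn0Sn i) zq).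
by rewrite ler_wpM2r ?powR_ge0// le_decr_rearr.
Qed.

Lemma sum_form_coef_le (r : seq multiindex) : uniq r ->
  (forall b, b \in r -> multideg b = m) ->
  \sum_(b <- r) normc (form_coef L b * monomial z b) <=
  (16 * expR 1) ^+ m * B ^+ m * poly_norm P.
Proof.
move=> ur rm.
(* Only the coordinates occurring in [r], in decreasing order of [|z|], so that each position obeys
   the bound on the rearrangement. *)
pose J := sort (fun j k => normc (z k) <= normc (z j))
  (undup (flatten [seq finsupp b : seq nat | b : multiindex <- r])).
have uJ : uniq J by rewrite sort_uniq undup_uniq.
have sJ : sorted (fun j k => normc (z k) <= normc (z j)) J.
  by apply: sort_sorted => j k; exact: le_total.
have rJ : {subset r <= multiindices J m}.
  move=> b br; rewrite mem_multiindices rm// eqxx/=; apply/allP => j jb.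
  rewrite /= mem_sort mem_undup; apply/flattenP; exists (finsupp b : seq nat) => //.
  by apply/mapP; exists b.
apply: (le_trans (ler_sum_normc_subset _ ur (undup_uniq _) rJ)).
pose N := (2 * m).+1; have mN : (m < N)%N by rewrite /N; lia.
rewrite (sum_multiindices (N := N) uJ mN).
pose c (a : {ffun 'I_(size J) -> 'I_N}) : R[i] :=
  if degree a == m then form_coef L (lift_exponent a) else 0.
rewrite big_mkcond/= (eq_bigr (fun a =>
  normc (c a) * \prod_(i < size J) normc (z (nth 0%N J i)) ^+ a i)); last first.
  move=> a _; rewrite /c; case: ifP => _; last by rewrite normc0 mul0r.
  rewrite normcM monomial_lift normc_prod; congr (_ * _).
  by apply: eq_bigr => i _; rewrite normcX.
pose y (j : nat) : R := j%:R `^ m%:R^-1.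
have y_ge0 j : 0 <= y j by exact: powR_ge0.
have yX j : y j ^+ m = j%:R.
  rewrite -powR_mulrn// -powRrM mulVf ?powRr1//.
  by rewrite pnatr_eq0; case: m m_gt0.
have -> : (16 * expR 1) ^+ m * B ^+ m * poly_norm P =
    (4 * expR 1) ^+ m * B ^+ m * (4 ^+ m * poly_norm P).
  rewrite (_ : 16 * expR 1 = 4 * expR 1 * 4); last by ring.
  by rewrite [in LHS]exprMn; ring.
apply: (sum_monomials_le m_gt0 y_ge0 yX B_ge0).
- by move=> i; exact: normc_ge0.
- by move=> i; exact: sorted_sqr_le.
- by move=> a /negPf am; rewrite /c am.
move=> v v2.
pose f j : R[i] := if insub (index j J) is Some i then v i else 0.
have f2 j : normc (f j) <= 2.
  by rewrite /f; case: insubP => [i _ _|_]; rewrite ?v2// normc0.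
pose zv := to_linfty f.
have zvE j : zv j = f j by exact: (to_linftyE _ f2).
have zvJ j : j \notin J -> zv j = 0.
  by move=> jJ; rewrite zvE /f insubF// index_mem; exact/negbTE.
rewrite [X in normc X](_ : _ = P zv).
  apply: (normc_poly_le Lmul Lbd uJ zvJ).
  by apply: linfty_norm_le => j; rewrite zvE.
rewrite /P (hpoly_expand Lmul uJ zvJ) (sum_multiindices (N := N) uJ mN).
rewrite [RHS]big_mkcond/=; apply: eq_bigr => a _; rewrite /c.
case: ifP => _; last by rewrite mul0r.
rewrite monomial_lift; congr (_ * _); apply: eq_bigr => i _.
by rewrite zvE /f index_uniq// valK.
Qed.

Lemma sum_form_coefT_le (r : seq multiindex) : uniq r ->
  \sum_(b <- r) normc (form_coef L b * monomial z b) <=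
  (16 * expR 1) ^+ m * B ^+ m * poly_norm P.
Proof.
move=> ur; rewrite (bigID (fun b => multideg b == m))/= [X in _ + X]big1 ?addr0; last first.
  by move=> b /negPf bm; rewrite /form_coef bm mul0r normc0.
rewrite -big_filter; apply: sum_form_coef_le; first by rewrite filter_uniq.
by move=> b; rewrite mem_filter => /andP[/eqP].
Qed.

(** Finite sums are uniformly bounded, hence absolute convergence. The sum is [P z] because
    truncations of [z] converge to it in norm and [P] is Lipschitz on balls, while at a truncation
    the expansion is finite. *)
Lemma abs_sums_to_form_coef :
  abs_sums_to setT (fun b => form_coef L b * monomial z b) (P z).
Proof.
apply: abs_sums_to_frequently.
  apply: le_lt_trans (ltry ((16 * expR 1) ^+ m * B ^+ m * poly_norm P)).
  by apply: esum_normc_le => r ur _; exact: sum_form_coefT_le.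
move=> e F e0; have [K K0 PK] := poly_lipschitz Lmul Lbd (linfty_norm z).
have eK : 0 < e / (K + 1) by rewrite divr_gt0// ltr_wpDl.
have [k0 zk0] := weak_tail_small q_gt0 zq eK.
(* [k] passes both the tail of [z] and the supports of all indices in [F]; members of [F] outside
   the expansion then have degree different from [m] and coefficient 0. *)
pose k := (k0 + \max_(j <- flatten [seq finsupp b : seq nat | b : multiindex <- enum_fset F]) j.+1)%N.
have kF b j : b \in F -> j \in finsupp b -> (j < k)%N.
  move=> bF jb; rewrite /k ltn_addl//.
  apply: (@leq_bigmax_seq _ _ xpredT S _ _ isT).
  by apply/flattenP; exists (finsupp b : seq nat) => //; apply/mapP; exists b.
pose f j := if (j < k)%N then z j else 0.
have fz j : normc (f j) <= linfty_norm z.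
  by rewrite /f; case: ifP => _; rewrite ?normc0 ?linfty_norm_ge0 ?normc_le_linfty_norm.
pose u := to_linfty f; have uE j : u j = f j by exact: to_linftyE fz.
have uJ j : j \notin iota 0 k -> u j = 0.
  by rewrite mem_iota add0n /= uE /f => /negPf ->.
exists (F `|` seq_fset tt (multiindices (iota 0 k) m))%fset; first exact: fsubsetUl.
rewrite (eq_bigl xpredT); last by move=> b; exact: in_setT.
rewrite (@big_subset_zero _ _ _ (multiindices (iota 0 k) m)) ?fset_uniq ?undup_uniq//; last 2 first.
- by move=> b bm; rewrite inE seq_fsetE bm orbT.
- move=> b; rewrite inE seq_fsetE mem_multiindices => /orP[bF|->//].
  rewrite negb_and => /orP[/negPf bm|/allPn[j jb]].
    by rewrite /form_coef bm mul0r.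
  by rewrite /= mem_iota add0n (kF b).
rewrite [X in normc (X - _)](_ : _ = P u); last first.
  rewrite /P (hpoly_expand Lmul (iota_uniq 0 k) uJ); apply: eq_big_seq => b.
  rewrite mem_multiindices => /andP[_ /allP bk]; congr (_ * _).
  apply: eq_big_seq => j /bk; rewrite /= mem_iota add0n /= uE /f => ->.
  by [].
apply: (le_trans (PK u z _ (lexx _))).
  by apply: linfty_norm_le => j; rewrite uE.
apply: (@le_trans _ _ (K * (e / (K + 1)))).
  rewrite ler_wpM2l//; apply: linfty_norm_le => j.
  have -> : (u - z) j = u j - z j by [].
  rewrite uE /f; case: ltnP => [_|kj]; first by rewrite subrr normc0 ltW.
  rewrite sub0r normcN zk0//; apply: leq_trans kj; exact: leq_addr.
rewrite mulrA ler_pdivrMr ?ltr_wpDl//; nra.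
Qed.

End upper_inclusion.

(** * Fourier matrices and complex series *)

Section fourier_chain.
Variables (R : realType) (n : nat) (w : R[i]).
Hypotheses (n_gt0 : (0 < n)%N) (wP : n.-primitive_root w).

Let w1 : normc w = 1.
Proof. exact: normc_unity n_gt0 (prim_expr_order wP). Qed.

Implicit Types x u v : nat -> 'I_n -> R[i].

(* [\sum_j chain x l j] is the [(l+1)]-linear form
   [\sum x_0(i_0) w^(i_0 i_1) x_1(i_1) w^(i_1 i_2) ... x_l(i_l)], whose
   coefficients are unimodular. *)
Fixpoint chain x (l : nat) (j : 'I_n) : R[i] :=
  if l is k.+1 then x k.+1 j * \sum_i chain x k i * w ^+ (i * j) else x 0%N j.

Lemma chain_ext x u l : (forall k, (k <= l)%N -> x k =1 u k) ->
  chain x l =1 chain u l.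
Proof.
elim: l => [|l IH] xu j /=; first exact: xu.
by rewrite xu//; congr (_ * _); apply: eq_bigr => i _; rewrite IH// => k kl; apply: xu; exact: leqW.
Qed.

Lemma chain_zero x k l j : (k <= l)%N -> (forall i, x k i = 0) -> chain x l j = 0.
Proof.
move=> + xk; elim: l j => [|l IH] j.
  by rewrite leqn0 => /eqP k0; rewrite /= -k0 xk.
rewrite leq_eqVlt => /orP[/eqP kl|]; first by rewrite /= -kl xk mul0r.
by rewrite ltnS => kl /=; rewrite big1 ?mulr0// => i _; rewrite IH// mul0r.
Qed.

Lemma chain_linear (a : R[i]) x u v k :
  (forall i, x k i = a * u k i + v k i) ->
  (forall l, l != k -> x l =1 u l /\ x l =1 v l) ->
  forall l j, (k <= l)%N -> chain x l j = a * chain u l j + chain v l j.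
Proof.
move=> xk xl; elim=> [|l IH] j.
  by rewrite leqn0 => /eqP k0 /=; rewrite -k0 xk.
rewrite leq_eqVlt => /orP[/eqP kl|].
  rewrite /= -kl xk mulrDl mulrA.
  have agree i : i \in predT -> chain x l i = chain u l i /\ chain x l i = chain v l i.
    by move=> _; split; apply: chain_ext => p pl; case: (xl p _) => //; rewrite kl neq_ltn ltnS pl.
  by congr (_ * _ + _ * _); apply: eq_bigr => i _; case: (agree i isT) => [h1 h2]; rewrite -?h1 -?h2.
move=> kl; have [xu xv] := xl l.+1 (negbT (gtn_eqF kl)); rewrite ltnS in kl => /=.
rewrite mulrCA -xu -xv -mulrDr; congr (_ * _).
by rewrite mulr_sumr -big_split; apply: eq_bigr => i _ /=; rewrite IH// mulrDl mulrA.
Qed.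

(** On basis vectors a single path survives, weighted by a power of [w]; this is why the
    coefficients are unimodular. *)
Lemma chain_basis x (t : nat -> 'I_n) l :
  (forall k, (k <= l)%N -> forall i, x k i = (i == t k)%:R) ->
  forall j, normc (chain x l j) = (j == t l)%:R.
Proof.
elim: l => [|l IH] xt j /=; rewrite xt//; first by rewrite normc_nat.
rewrite normcM normc_nat (bigD1 (t l))//= big1 ?addr0; last first.
  move=> i it; rewrite (_ : chain x l i = 0) ?mul0r//; apply/eqP.
  rewrite -normc_eq0 IH ?(negPf it)// => k kl; apply: xt; exact: leqW.
rewrite normcM normcX w1 expr1n mulr1 IH ?eqxx ?mulr1// => k kl.
by apply: xt; exact: leqW.
Qed.

Lemma chain_basis_sum x (t : nat -> 'I_n) l :
  (forall k, (k <= l)%N -> forall i, x k i = (i == t k)%:R) ->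
  normc (\sum_j chain x l j) = 1.
Proof.
move=> xt; rewrite (bigD1 (t l))//= big1 ?addr0; last first.
  by move=> j jt; apply/eqP; rewrite -normc_eq0 (chain_basis xt) (negPf jt).
by rewrite (chain_basis xt) eqxx.
Qed.

Lemma fourier_parseval (a : 'I_n -> R[i]) :
  \sum_(j < n) normc (\sum_(i < n) a i * w ^+ (i * j)) ^+ 2 = n%:R * \sum_i normc (a i) ^+ 2.
Proof.
apply: complexI; rewrite rmorphM !rmorph_sum rmorph_nat /=.
have wx k : normc (w ^+ k) = 1 by rewrite normcX w1 expr1n.
under eq_bigr => j _.
  rewrite normc_sqr rmorph_sum/= big_distrlr/=.
  under eq_bigr => i _.
    under eq_bigr => k _.
      rewrite rmorphM/= (conjc_unit (wx _)) mulrACA !(mulnC _ j) !exprM.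
      over.
    over.
  over.
rewrite exchange_big/= big_distrr/=; apply: eq_bigr => i _.
rewrite exchange_big/= (bigD1 i)//= -mulr_sumr (sum_unity_root n_gt0 wP) eqxx.
rewrite big1 ?addr0 ?normc_sqr 1?mulrC// => k ki.
rewrite -mulr_sumr (sum_unity_root n_gt0 wP) !modn_small//.
by rewrite eq_sym -[_ == _ :> nat]/(k == i) (negPf ki) mulr0.
Qed.

(** Each of the [l] Fourier steps costs [n^(1/2)] by [fourier_parseval], the passage from the sup
    norm to [l_2] in slot 0 another, and the final Cauchy-Schwarz a last one; hence the exponent
    [l + 2]. *)
Lemma chain_bound x (X : nat -> R) l :
  (forall k i, (k <= l)%N -> normc (x k i) <= X k) ->
  normc (\sum_j chain x l j) <=
    Num.sqrt (n%:R ^+ l.+2) * \prod_(k < l.+1) X k.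
Proof.
move=> xX; have X_ge0 k : (k <= l)%N -> 0 <= X k.
  by move=> kl; apply: le_trans (xX k (Ordinal n_gt0) kl); exact: normc_ge0.
have sq p : (p <= l)%N -> \sum_j normc (chain x p j) ^+ 2 <=
    n%:R ^+ p.+1 * (\prod_(k < p.+1) X k) ^+ 2.
  elim: p => [|p IH] pl.
    rewrite expr1 big_ord1; apply: (@le_trans _ _ (\sum_(j < n) X 0%N ^+ 2)).
      by apply: ler_sum => j _; rewrite lerXn2r ?nnegrE ?normc_ge0 ?X_ge0 ?xX.
    by rewrite sumr_const card_ord mulr_natl.
  apply: (@le_trans _ _ (X p.+1 ^+ 2 *
      \sum_(j < n) normc (\sum_(i < n) chain x p i * w ^+ (i * j)) ^+ 2)).
    rewrite mulr_sumr; apply: ler_sum => j _ /=; rewrite normcM exprMn.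
    by rewrite ler_wpM2r ?sqr_ge0// lerXn2r ?nnegrE ?normc_ge0 ?X_ge0 ?xX.
  rewrite fourier_parseval big_ord_recr/= exprMn.
  rewrite [leRHS](_ : _ = X p.+1 ^+ 2 * (n%:R *
     (n%:R ^+ p.+1 * (\prod_(k < p.+1) X k) ^+ 2))).
    by rewrite ler_wpM2l ?sqr_ge0// ler_wpM2l// IH// ltnW.
  by rewrite [n%:R ^+ p.+2]exprS; ring.
have P0 : 0 <= \prod_(k < l.+1) X k.
  by apply: prodr_ge0 => k _; apply: X_ge0; rewrite -ltnS.
rewrite -(ger0_norm P0) -sqrtr_sqr -sqrtrM ?exprn_ge0//.
rewrite -[leLHS]ger0_norm ?normc_ge0// -sqrtr_sqr ler_wsqrtr//.
apply: (@le_trans _ _ ((\sum_j 1 * normc (chain x l j)) ^+ 2)).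
  rewrite lerXn2r ?nnegrE ?normc_ge0//.
    by apply: sumr_ge0 => j _; rewrite mul1r normc_ge0.
  rewrite [leRHS](eq_bigr (fun j => normc (chain x l j))); first exact: normc_sum.
  by move=> j _; rewrite mul1r.
apply: (le_trans (sum_cauchy_schwarz _ _ _)).
rewrite [X in X * _](eq_bigr (fun=> 1)) => [|? _]; last by rewrite expr1n.
by rewrite sumr_const card_ord exprS -mulrA ler_wpM2l// sq.
Qed.

End fourier_chain.

Section complex_series.
Variable R : realType.
Implicit Types (f g : nat -> R[i]) (s : R[i]).

Definition csums_to f s : Prop :=
  (series (fun k => complex.Re (f k)) @ \oo --> complex.Re s) /\
  (series (fun k => complex.Im (f k)) @ \oo --> complex.Im s).

Definition csum f : R[i] := xget 0 [set s | csums_to f s].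

Lemma csums_to_unique f s s' : csums_to f s -> csums_to f s' -> s = s'.
Proof.
move=> [a b] [a' b']; apply/eqP; rewrite eq_complex; apply/andP.
by split; apply/eqP; [exact: cvg_unique a a'|exact: cvg_unique b b'].
Qed.

Lemma csumE f s : csums_to f s -> csum f = s.
Proof.
move=> fs; apply: (csums_to_unique _ fs).
rewrite /csum; case: xgetP => [t _ //|nf]; by case: (nf s fs).
Qed.

Lemma cvg_series_linear (F G H : R ^nat) (a b F' G' H' : R) :
  series F @ \oo --> F' -> series G @ \oo --> G' -> series H @ \oo --> H' ->
  series (fun k => a * F k + b * G k + H k) @ \oo --> a * F' + b * G' + H'.
Proof.
move=> cF cG cH.
have -> : series (fun k => a * F k + b * G k + H k) =
    (fun n => a * series F n + b * series G n + series H n).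
  by apply/funext => n; rewrite /series/= !mulr_sumr -!big_split.
by apply: cvgD => //; apply: cvgD; apply: cvgMr.
Qed.

Lemma csums_to_linear (a : R[i]) f g s t : csums_to f s -> csums_to g t ->
  csums_to (fun k => a * f k + g k) (a * s + t).
Proof.
move=> [fr fi] [gr gi]; split.
  have -> : complex.Re (a * s + t) =
      complex.Re a * complex.Re s + (- complex.Im a) * complex.Im s + complex.Re t.
    by case: a s t {fr fi gr gi} => [? ?] [? ?] [? ?] /=; rewrite mulNr.
  rewrite (_ : (fun k => _) = (fun k => complex.Re a * complex.Re (f k) +
      (- complex.Im a) * complex.Im (f k) + complex.Re (g k))).
    exact: cvg_series_linear.
  by apply/funext => k; case: a (f k) (g k) => [? ?] [? ?] [? ?] /=; rewrite mulNr.
have -> : complex.Im (a * s + t) =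
    complex.Im a * complex.Re s + complex.Re a * complex.Im s + complex.Im t.
  by case: a s t {fr fi gr gi} => [? ?] [? ?] [? ?] /=; congr (_ + _); rewrite addrC.
rewrite (_ : (fun k => _) = (fun k => complex.Im a * complex.Re (f k) +
    complex.Re a * complex.Im (f k) + complex.Im (g k))).
  exact: cvg_series_linear.
apply/funext => k; case: a (f k) (g k) => [? ?] [? ?] [? ?] /=.
by congr (_ + _); rewrite addrC.
Qed.

Lemma csums_to_single f k : (forall j, j != k -> f j = 0) -> csums_to f (f k).
Proof.
move=> f0; split; apply: cvg_near_cst; exists k.+1 => // n /= kn;
  rewrite /series/= (bigD1_seq k) ?mem_index_iota ?iota_uniq//= big1 ?addr0// => j /f0 -> //.
Qed.

Lemma cvg_series_dominated (h : R ^nat) (K : R) : (forall k, `|h k| <= K / 2 ^+ k) ->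
  cvgn (series h) /\ `|limn (series h)| <= 2 * K.
Proof.
move=> hK; have n21 : `|2^-1 : R| < 1 by rewrite ger0_norm// invf_lt1//; lra.
have gE k : K / 2 ^+ k = geometric K (2^-1) k by rewrite /geometric/= exprVn.
have gc := @is_cvg_geometric_series R K _ n21.
have nc : cvgn [normed series h].
  apply: series_le_cvg gc => k; rewrite -?gE.
  - exact: normr_ge0.
  - exact: le_trans (normr_ge0 _) (hK k).
  - exact: hK.
split; first exact: normed_cvg.
apply: (le_trans (lim_series_norm nc)).
apply: (le_trans (lim_series_le nc gc _)); first by move=> k; rewrite -gE; exact: hK.
rewrite (cvg_lim _ (@cvg_geometric_series R K _ n21))//.
have -> : 1 - 2^-1 = 2^-1 :> R by lra.
by rewrite invrK mulrC.
Qed.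

(** The real and the imaginary part contribute [2 K] each. *)
Lemma csum_dominated f (K : R) : (forall k, normc (f k) <= K / 2 ^+ k) ->
  csums_to f (csum f) /\ normc (csum f) <= 4 * K.
Proof.
move=> fK.
have Re_le (z : R[i]) : `|complex.Re z| <= normc z.
  case: z => a b /=; rewrite -sqrtr_sqr ler_wsqrtr// lerDl sqr_ge0//.
have Im_le (z : R[i]) : `|complex.Im z| <= normc z.
  case: z => a b /=; rewrite -sqrtr_sqr ler_wsqrtr// lerDr sqr_ge0//.
have [rc rK] := cvg_series_dominated (fun k => le_trans (Re_le (f k)) (fK k)).
have [ic iK] := cvg_series_dominated (fun k => le_trans (Im_le (f k)) (fK k)).
pose s : R[i] := Complex (limn (series (fun k => complex.Re (f k))))
                         (limn (series (fun k => complex.Im (f k)))).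
have fs : csums_to f s by split.
rewrite (csumE fs); split=> //.
have -> : s = (complex.Re s)%:C + 'i%C * (complex.Im s)%:C by rewrite -complexE.
apply: (le_trans (le_normcD _ _)); rewrite normcM !normc_real.
rewrite (_ : normc 'i%C = 1) ?mul1r; last by rewrite /normc/= expr0n expr1n add0r sqrtr1.
rewrite (_ : 4 * K = 2 * K + 2 * K); last by ring.
exact: lerD.
Qed.

End complex_series.

(** * Sums of block forms *)

Section block_form.
Variables (R : realType) (m' : nat).
Let m := m'.+1.
Variables (n_ : nat -> nat) (w_ : nat -> R[i]) (g : nat -> nat -> nat -> nat).
Hypothesis n_gt0 : forall k, (0 < n_ k)%N.
Hypothesis wP : forall k, (n_ k).-primitive_root (w_ k).
Hypothesis g_inj : forall k l i k' l' i',
  (l < m)%N -> (i < n_ k)%N -> (l' < m)%N -> (i' < n_ k')%N ->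
  g k l i = g k' l' i' -> [/\ k = k', l = l' & i = i'].
Implicit Types x : 'I_m -> linfty R.

(** Block [k] is made of [m] groups of [n_ k] coordinates, and slot [l] reads group [l] only. The
    value 0 is a filler for [l >= m], which [chain] at [m'] never reaches. *)
Definition block_entries k x (l : nat) (i : 'I_(n_ k)) : R[i] :=
  if (l < m)%N then x (inord l) (g k l i) else 0.

Definition block_form k x : R[i] :=
  \sum_j chain (w_ k) (@block_entries k x) m' j.

(** The square root is the constant of [chain_bound]; dividing by it and by [2^k] makes the series
    of forms converge geometrically. *)
Definition block_weight k : R := (2 ^+ k * Num.sqrt ((n_ k)%:R ^+ m.+1))^-1.

Definition hump_form x : R[i] := csum (fun k => (block_weight k)%:C * block_form k x).

Lemma block_weight_gt0 k : 0 < block_weight k.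
Proof.
by rewrite invr_gt0 mulr_gt0 ?exprn_gt0 ?sqrtr_gt0 ?exprn_gt0 ?ltr0n.
Qed.

Lemma hump_term_le k x : normc ((block_weight k)%:C * block_form k x) <=
  (\prod_l linfty_norm (x l)) / 2 ^+ k.
Proof.
rewrite normcM normc_real ger0_norm ?(ltW (block_weight_gt0 k))//.
have := @chain_bound R _ _ (n_gt0 k) (wP k) (@block_entries k x)
  (fun l => linfty_norm (x (inord l))) m'.
have -> : \prod_(l < m) linfty_norm (x (inord l)) = \prod_l linfty_norm (x l).
  by apply: eq_bigr => l _; rewrite inord_val.
have bx l i : (l <= m')%N ->
    normc (@block_entries k x l i) <= linfty_norm (x (inord l)).
  by move=> lm; rewrite /block_entries ltnS lm normc_le_linfty_norm.
move=> /(_ bx) h; have /(ler_wpM2l (ltW (block_weight_gt0 k))) := h.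
move=> /le_trans; apply; rewrite /block_weight -/m.
have : Num.sqrt ((n_ k)%:R ^+ m.+1) != 0 :> R.
  by rewrite gt_eqF// sqrtr_gt0 exprn_gt0// ltr0n n_gt0.
set S := Num.sqrt _ => S0; rewrite le_eqVlt; apply/orP; left; apply/eqP.
by rewrite invfM -mulrA (mulKf S0) mulrC.
Qed.

Lemma hump_form_csums x :
  csums_to (fun k => (block_weight k)%:C * block_form k x) (hump_form x).
Proof. by case: (csum_dominated (fun k => hump_term_le k x)). Qed.

Lemma hump_form_bounded : bounded_form hump_form.
Proof.
exists 4 => x.
by case: (csum_dominated (fun k => hump_term_le k x)).
Qed.

Lemma block_form_multilinear k : multilinear (block_form k).
Proof.
move=> i x a u v; rewrite /block_form mulr_sumr -big_split; apply: eq_bigr => j _ /=.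
apply: (@chain_linear R _ _ a _ _ _ i) => [p|l li|]; last by rewrite -ltnS.
  by rewrite /block_entries ltn_ord inord_val /= eqxx.
split=> p; rewrite /block_entries; case: ltnP => // lm /=;
  by rewrite -val_eqE/= inordK// (negPf li).
Qed.

Lemma hump_form_multilinear : multilinear hump_form.
Proof.
move=> i x a u v; apply: csumE.
have := csums_to_linear a (hump_form_csums [eta x with i |-> u])
  (hump_form_csums [eta x with i |-> v]).
congr (csums_to _ _); apply/funext => k.
by rewrite block_form_multilinear; ring.
Qed.

Section coefficient.
Variables (k : nat) (t : 'I_m -> 'I_(n_ k)).

(** One coordinate from each group of block [k], in the order of the slots. *)
Definition transversal : seq nat := [seq g k l (t l) | l : 'I_m <- enum 'I_m].

Lemma nth_transversal (l : 'I_m) : nth 0%N transversal l = g k l (t l).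
Proof. by rewrite (nth_map ord0) ?size_enum_ord// nth_ord_enum. Qed.

Lemma size_transversal : size transversal = m.
Proof. by rewrite size_map size_enum_ord. Qed.

Lemma block_form_transversal :
  normc (block_form k (fun l => basis_vec R (nth 0%N transversal l))) = 1.
Proof.
apply: (@chain_basis_sum R _ _ (n_gt0 k) (wP k) _ (fun l => t (inord l))) => l lm i.
have lm1 : (l < m)%N by rewrite ltnS.
rewrite /block_entries lm1 basis_vecE nth_transversal inordK//.
congr (nat_of_bool _)%:R; apply/eqP/eqP => [/g_inj[]// _ _ ii'|->//].
exact/val_inj.
Qed.

Lemma block_form_zero (k' : nat) (x : 'I_m -> linfty R) (l : 'I_m) :
  (forall i : 'I_(n_ k'), x l (g k' l i) = 0) -> block_form k' x = 0.
Proof.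
move=> x0; rewrite /block_form big1// => j _; apply: (@chain_zero _ _ _ _ l).
  by rewrite -ltnS.
by move=> i; rewrite /block_entries ltn_ord inord_val x0.
Qed.

(** In another block, slot 0 meets a foreign coordinate; in the same block, a nontrivial
    rearrangement puts into some slot a coordinate of another group. Either way a factor
    vanishes. *)
Lemma block_form_permuted (k' : nat) (s : seq nat) :
  perm_eq s transversal -> (k' != k) || (s != transversal) ->
  block_form k' (fun l => basis_vec R (nth 0%N s l)) = 0.
Proof.
move=> ps neq; have ss : size s = m by rewrite (perm_size ps) size_transversal.
have sE (l : 'I_m) : exists l' : 'I_m, nth 0%N s l = g k l' (t l').
  have : nth 0%N s l \in transversal by rewrite -(perm_mem ps) mem_nth ?ss.
  by case/mapP => l' _ ->; exists l'.
have [kk|kk] := eqVneq k' k; last first.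
  apply: (@block_form_zero k' _ ord0) => i; rewrite basis_vecE.
  have [l' ->] := sE ord0; case: eqP => // /g_inj[]// kk'.
  by rewrite kk' eqxx in kk.
rewrite kk eqxx /= in neq *; rewrite {k' kk}.
have [l sl] : exists l : 'I_m, nth 0%N s l != nth 0%N transversal l.
  apply/existsP; apply: contraNT neq => /existsPn sl.
  apply/eqP/(@eq_from_nth _ 0%N); first by rewrite ss size_transversal.
  by move=> j; rewrite ss => jm; have /negPn/eqP := sl (Ordinal jm).
apply: (@block_form_zero k _ l) => i; rewrite basis_vecE.
case: eqP => // gi; case/eqP: sl; have [l' sl'] := sE l.
rewrite nth_transversal sl'; move: gi; rewrite sl' => /g_inj[]// _ ll' _.
by rewrite (val_inj ll').
Qed.

(** Among all blocks and all arrangements of the word exactly one contributes, with modulus 1 before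
    weighting. *)
Lemma hump_form_coef :
  normc (form_coef hump_form (word_exponent transversal)) = block_weight k.
Proof.
rewrite /form_coef multideg_word_exponent size_transversal eqxx.
have hE s : perm_eq s transversal ->
    hump_form (fun l => basis_vec R (nth 0%N s l)) =
    (block_weight k)%:C * block_form k (fun l => basis_vec R (nth 0%N s l)).
  move=> ps; apply: csumE.
  apply: (csums_to_single (f := fun k' => (block_weight k')%:C *
    block_form k' (fun l => basis_vec R (nth 0%N s l)))) => k' kk'.
  by rewrite block_form_permuted ?kk'// mulr0.
have ptt s : perm_eq s (word (word_exponent transversal)) -> perm_eq s transversal.
  move=> h; rewrite (perm_trans h)// perm_sym perm_word//.
rewrite (bigD1_seq transversal) ?permutations_uniq ?mem_permutations ?perm_word//=.
rewrite big1_seq ?addr0; last first.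
  move=> s /andP[st]; rewrite mem_permutations => /ptt ps.
  by rewrite hE// block_form_permuted ?st ?orbT// mulr0.
rewrite hE// normcM block_form_transversal mulr1 normc_real.
by rewrite ger0_norm// ltW// block_weight_gt0.
Qed.

End coefficient.

Lemma transversal_inj k : injective
  (fun t : {ffun 'I_m -> 'I_(n_ k)} => word_exponent (transversal t)).
Proof.
move=> t t' tt'; apply/ffunP => l.
have : g k l (t l) \in transversal t' .
  rewrite -mem_word_exponent -tt' mem_word_exponent; apply/mapP; exists l => //.
  by rewrite mem_enum.
case/mapP => l' _ /g_inj[]// _ ll'; rewrite (val_inj ll').
exact: val_inj.
Qed.

(** The [n_k^m] transversals contribute at least [block_weight k] times [d^m] each. Of the factor
    [4^k] in the hypothesis, one [2^k] pays for the weight and the other is the lower bound. *)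
Lemma hump_sum_ge (z : linfty R) k (d : R) : 0 <= d ->
  (forall l i, (l < m)%N -> (i < n_ k)%N -> d <= normc (z (g k l i))) ->
  4 ^+ k * Num.sqrt ((n_ k)%:R ^+ m.+1) <= d ^+ m * (n_ k)%:R ^+ m ->
  ((2 ^+ k)%:E <= \esum_(b in [set: multiindex])
      (normc (form_coef hump_form b * monomial z b))%:E)%E.
Proof.
move=> d0 dz h.
pose r := [seq word_exponent (transversal t) | t : {ffun 'I_m -> 'I_(n_ k)} <- enum {ffun 'I_m -> 'I_(n_ k)}].
have ur : uniq r by rewrite map_inj_uniq ?enum_uniq//; exact: transversal_inj.
apply: (@le_trans _ _ (\sum_(b <- r) normc (form_coef hump_form b * monomial z b))%:E); last first.
  exact: le_esum_normc.
rewrite lee_fin big_map big_enum/=.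
apply: (@le_trans _ _ (\sum_(t : {ffun 'I_m -> 'I_(n_ k)}) block_weight k * d ^+ m)); last first.
  apply: ler_sum => t _; rewrite normcM hump_form_coef.
  rewrite ler_wpM2l ?(ltW (block_weight_gt0 k))// monomial_word_exponent.
  rewrite normc_prod big_map big_enum/=.
  rewrite -[X in d ^+ X](card_ord m) -prodr_const; apply: ler_prod => l _.
  by rewrite d0 dz.
rewrite sumr_const card_ffun !card_ord -[X in _ <= X]mulr_natr natrX -mulrA.
rewrite /block_weight mulrC ler_pdivlMr ?mulr_gt0 ?exprn_gt0 ?sqrtr_gt0 ?exprn_gt0 ?ltr0n//.
rewrite mulrA -exprMn; apply: le_trans h.
by rewrite (_ : 2 * 2 = 4)//; ring.
Qed.

End block_form.

(** * The lower estimate *)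

(** The first [M] of [K] indices are given up and the rest is cut into [m] groups. At least half of
    [K] is left, and rounding down loses at most half of that, so the group size stays comparable to
    [K / m]. *)
Lemma block_length_bounds (M m K : nat) : (0 < m)%N -> (2 * (M + m) < K)%N ->
  [/\ (0 < (K - M) %/ m)%N, (m * ((K - M) %/ m) <= K - M)%N &
      (K <= 4 * m * ((K - M) %/ m))%N].
Proof.
move=> m0 MK; have mKM : (m <= K - M)%N by lia.
have n0 : (0 < (K - M) %/ m)%N by rewrite divn_gt0.
have mn : (m * ((K - M) %/ m) <= K - M)%N by rewrite mulnC leq_divM.
split=> //; have := ltn_ceil (K - M) m0.
set n := ((K - M) %/ m)%N in n0 mn *; rewrite mulSn => h.
have : (m <= n * m)%N by rewrite leq_pmull.
have -> : (4 * m * n = 4 * (n * m))%N by ring.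
by lia.
Qed.

Lemma pair_index_bound (m n l i s : nat) :
  (m * n <= s)%N -> (l < m)%N -> (i < n)%N -> (l * n + i < s)%N.
Proof.
move=> mn lm im; apply: leq_trans mn; apply: (@leq_trans (l.+1 * n)).
  by rewrite mulSn addnC ltn_add2r.
by rewrite leq_mul2r lm orbT.
Qed.

Section selection.
Variables (R : realType) (m : nat) (z : linfty R).
Hypothesis m_gt1 : (2 <= m)%N.
Let q : R := (2 * m)%:R / (m.-1)%:R.

Lemma decr_rearr_le_norm n : (0 < n)%N -> decr_rearr z n <= linfty_norm z.
Proof.
move=> n0; have [_ lb] := decr_rearr_lower z n0.
apply: (@le_trans _ _ (sup [set normc (z j) | j in ~` [set` (fset0 : {fset nat})]])).
  by apply: ge_inf => //; exists fset0 => //=; rewrite cardfs0.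
apply: ge_sup; first by case: (tail_sup_has_sup z (cofinite_nonempty fset0)).
by move=> _ [j _ <-]; exact: normc_le_linfty_norm.
Qed.

(** Greedy choice: after removing fewer than [n] indices already found, the supremum of the rest is
    still at least the rearrangement at [n], hence above [d]. *)
Lemma decr_rearr_many (d : R) n p : (p <= n)%N -> d < decr_rearr z n ->
  exists r : seq nat, [/\ uniq r, size r = p & forall j, j \in r -> d <= normc (z j)].
Proof.
elim: p => [|p IH] pn dn; first by exists [::].
have [r [ur sr rd]] := IH (ltnW pn) dn; pose F := seq_fset tt r.
have n0 : (0 < n)%N by exact: leq_ltn_trans pn.
have dF : d < sup [set normc (z j) | j in ~` [set` F]].
  apply: (lt_le_trans dn); apply: ge_inf; first by case: (decr_rearr_lower z n0).
  exists F => //; rewrite /mkset; apply: leq_ltn_trans pn.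
  rewrite -sr; apply: (@uniq_leq_size _ (enum_fset F)); first exact: fset_uniq.
  by move=> j; rewrite seq_fsetE.
have [|_ [j jF <-] dj] := sup_gt _ dF.
  by case: (tail_sup_has_sup z (cofinite_nonempty F)).
have jr : j \notin r by apply/negP => jr; apply: jF; rewrite /= seq_fsetE.
exists (j :: r); split => /=; rewrite ?jr ?sr// => i.
by rewrite inE => /orP[/eqP ->|/rd//]; exact: ltW.
Qed.

Lemma weak_norm_unbounded (T : R) : weak_norm q z = +oo%E ->
  exists2 n, (0 < n)%N & T < decr_rearr z n * n%:R `^ q^-1.
Proof.
move=> zoo; apply: contrapT => noT.
have : (weak_norm q z <= T%:E)%E.
  apply: ge_ereal_sup => _ [n /= n0 <-]; rewrite lee_fin leNgt; apply/negP => Tn.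
  by apply: noT; exists n.
by rewrite zoo leye_eq.
Qed.

Lemma block_selection (M : nat) (T : R) : 0 <= T -> weak_norm q z = +oo%E ->
  exists n (g : nat -> nat -> nat) (d : R), [/\ (0 < n)%N, 0 <= d,
    (forall l i, (l < m)%N -> (i < n)%N -> (M <= g l i)%N /\ d <= normc (z (g l i))),
    (forall l i l' i', (l < m)%N -> (i < n)%N -> (l' < m)%N -> (i' < n)%N ->
       g l i = g l' i' -> l = l' /\ i = i') &
    T * Num.sqrt (n%:R ^+ m.+1) <= d ^+ m * n%:R ^+ m].
Proof.
move=> T0 zoo; pose Z := linfty_norm z; have Z0 : 0 <= Z := linfty_norm_ge0 z.
(* The first summand forces [K > 2 (M + m)], because the rearrangement is at most [Z] and
   [K^(1/q) <= K]; the second leaves room for the losses 2 in [d] and [4 m] in the block length. *)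
pose T' : R := Z * (2 * (M + m))%:R + (8 * m)%:R * (T + 1).
have [K K0 TK] := weak_norm_unbounded T' zoo.
have q0 : 0 < q by rewrite divr_gt0 ?ltr0n//; lia.
have q1 : q^-1 <= 1.
  by rewrite invf_le1// ler_pdivlMr ?mul1r ?ler_nat ?ltr0n; lia.
have KR : 1 <= K%:R :> R by rewrite ler1n.
pose rho : R := K%:R `^ q^-1; have rho_ge0 : 0 <= rho by exact: powR_ge0.
have rho_le : rho <= K%:R.
  by rewrite -[leRHS]powRr1// ler_powR.
have rhoX : rho ^+ (2 * m) = K%:R ^+ m.-1.
  rewrite /rho -!powR_mulrn ?powR_ge0// -powRrM; congr (_ `^ _).
  by rewrite /q invf_div divfK// pnatr_eq0; lia.
pose zK := decr_rearr z K; have zK_le : zK <= Z by exact: decr_rearr_le_norm.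
have zK0 : 0 <= zK by exact: decr_rearr_ge0.
have T1_ge0 : 0 <= (8 * m)%:R * (T + 1) by rewrite mulr_ge0// addr_ge0.
have K_gt : (2 * (M + m) < K)%N.
  rewrite ltnNge; apply/negP => KM; move: TK; rewrite -/rho -/zK ltNge => /negP; apply.
  apply: (@le_trans _ _ (Z * (2 * (M + m))%:R)); last by rewrite /T' lerDl.
  by rewrite ler_pM// (le_trans rho_le)// ler_nat.
have zrho : (8 * m)%:R * (T + 1) < zK * rho.
  by apply: le_lt_trans TK; rewrite /T' lerDr mulr_ge0.
have zK_gt0 : 0 < zK.
  rewrite lt_neqAle zK0 andbT; apply: contraTneq zrho => <-.
  by rewrite mul0r -leNgt.
pose d := zK / 2; have d0 : 0 <= d by rewrite divr_ge0.
have d_lt : d < zK by rewrite /d ltr_pdivrMr//; lra.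
have [r [ur sr rd]] := decr_rearr_many (leqnn K) d_lt.
pose J := [seq j <- r | (M <= j)%N].
have sJ : (K - M <= size J)%N.
  rewrite leq_subLR -sr -(count_predC (fun j => M <= j)%N r) size_filter addnC leq_add2r.
  rewrite -size_filter -[X in (_ <= X)%N](size_iota 0 M); apply: uniq_leq_size.
    exact: filter_uniq.
  by move=> j; rewrite mem_filter mem_iota /= -ltnNge => /andP[].
pose n := ((K - M) %/ m)%N.
have [n0 mn K4] := block_length_bounds (ltnW m_gt1) K_gt; rewrite -/n in n0 mn K4.
have idx l i : (l < m)%N -> (i < n)%N -> (l * n + i < size J)%N.
  by move=> lm im; apply: pair_index_bound lm im; exact: leq_trans sJ.
exists n, (fun l i => nth 0%N J (l * n + i)), d; split=> //.
- move=> l i lm im; have : nth 0%N J (l * n + i) \in J by rewrite mem_nth ?idx.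
  by rewrite mem_filter => /andP[-> /rd].
- move=> l i l' i' lm im lm' im' /eqP; rewrite nth_uniq ?filter_uniq ?idx// => /eqP e.
  have il : l = l'.
    by move/(congr1 (divn^~ n)): e; rewrite !divnMDl// !divn_small// !addn0.
  by split=> //; move: e; rewrite il => /addnI.
rewrite -(@ler_sqr _ (T * _)) ?nnegrE ?mulr_ge0 ?sqrtr_ge0 ?exprn_ge0//.
rewrite [in leLHS]exprMn sqr_sqrtr ?exprn_ge0// -exprMn -exprM.
have nR : 0 < n%:R :> R by rewrite ltr0n.
(* Squared and divided by [n^(m+1)], the claim involves integer powers only. *)
suff : T ^+ 2 <= d ^+ (2 * m) * n%:R ^+ m.-1.
  have n1 : 0 <= n%:R ^+ m.+1 :> R by rewrite exprn_ge0.
  move=> /(ler_wpM2r n1) /le_trans; apply; rewrite -mulrA -exprD [leRHS]exprMn.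
  have -> : (m * 2 = 2 * m)%N by rewrite mulnC.
  have -> : (m.-1 + m.+1 = 2 * m)%N; last exact: lexx.
  by rewrite addnS -addSn prednK ?(ltnW m_gt1)// addnn mul2n.
have a_gt0 : 0 < (4 * m)%:R :> R by rewrite ltr0n muln_gt0 (ltnW m_gt1).
have a_ge1 : 1 <= (4 * m)%:R :> R by rewrite ler1n muln_gt0 (ltnW m_gt1).
(* This is the [2m]-th power of [4 m (T + 1) <= d rho]. With [K <= 4 m n] the loss is [(4 m)^(m-1)],
   which [(4 m)^(2m)] absorbs, and [(T + 1)^(2m)] dominates [T^2]. *)
have step : ((4 * m)%:R * (T + 1)) ^+ (2 * m) <= d ^+ (2 * m) * K%:R ^+ m.-1.
  rewrite -rhoX -exprMn lerXn2r ?nnegrE ?mulr_ge0 ?addr_ge0//.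
  by move: zrho; rewrite /d !natrM; nra.
have step2 : d ^+ (2 * m) * K%:R ^+ m.-1 <= d ^+ (2 * m) * ((4 * m)%:R * n%:R) ^+ m.-1.
  rewrite ler_wpM2l ?exprn_ge0// lerXn2r ?nnegrE ?mulr_ge0//.
  by rewrite -natrM ler_nat.
have am_gt0 : 0 < (4 * m)%:R ^+ m.-1 :> R by rewrite exprn_gt0.
rewrite -(ler_pM2l am_gt0); apply: le_trans (le_trans (le_trans step step2) _); last first.
  by rewrite [X in _ * X <= _]exprMn [leLHS]mulrCA.
rewrite exprMn ler_pM ?exprn_ge0//.
  by apply: ler_weXn2l => //; exact: leq_trans (leq_pred m) (leq_pmull m _).
apply: (@le_trans _ _ ((T + 1) ^+ 2)).
  by rewrite lerXn2r ?nnegrE ?addr_ge0// lerDl.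
apply: ler_weXn2l; first by rewrite lerDr.
by rewrite mul2n -addnn; exact: leq_trans m_gt1 (leq_addr _ _).
Qed.

End selection.

Lemma mon_subset_weak_lq (R : realType) (m : nat) (z : linfty R) : (2 <= m)%N ->
  mon m z -> weak_lq ((2 * m)%:R / (m.-1)%:R) z.
Proof.
case: m => [//|m'] m2 zmon; rewrite /weak_lq /= ltey; apply/eqP => zoo.
(* [p] holds a lower bound for the coordinates and a stage; [d.1.2] is an upper bound, where the
   next block may start. *)
pose spec (p : nat * nat) (d : nat * (nat -> nat -> nat) * nat * R) :=
  [/\ (0 < d.1.1.1)%N, 0 <= d.2,
    (forall l i, (l < m'.+1)%N -> (i < d.1.1.1)%N ->
      (p.1 <= d.1.1.2 l i < d.1.2)%N /\ d.2 <= normc (z (d.1.1.2 l i))),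
    (forall l i l' i', (l < m'.+1)%N -> (i < d.1.1.1)%N -> (l' < m'.+1)%N -> (i' < d.1.1.1)%N ->
       d.1.1.2 l i = d.1.1.2 l' i' -> l = l' /\ i = i') &
    4 ^+ p.2 * Num.sqrt (d.1.1.1%:R ^+ m'.+2) <= d.2 ^+ m'.+1 * d.1.1.1%:R ^+ m'.+1].
have /choice[D DP] p : exists d, spec p d.
  have [n [g [d [n0 d0 gP gI h]]]] :=
    block_selection m2 p.1 (exprn_ge0 p.2 (ler0n R 4)) zoo.
  exists (n, g, (\max_(l < m'.+1) \max_(i < n) (g l i).+1)%N, d); split=> //= l i lm im.
  have [-> ->] := gP l i lm im; split=> //=.
  apply: leq_trans (leq_bigmax (Ordinal lm)).
  exact: (leq_bigmax (F := fun i : 'I_n => (g l i).+1) (Ordinal im)).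
(* The blocks occupy successive intervals from [M k] to [M k.+1], hence are disjoint, and the block
   of stage [k] exceeds its norm bound by [4^k]. *)
pose fix M k := if k is k'.+1 then (D (M k', k')).1.2 else 0%N.
pose n_ k := (D (M k, k)).1.1.1; pose g k := (D (M k, k)).1.1.2.
pose d k := (D (M k, k)).2.
have n_gt0 k : (0 < n_ k)%N by case: (DP (M k, k)).
have gM k l i : (l < m'.+1)%N -> (i < n_ k)%N -> (M k <= g k l i < M k.+1)%N.
  by move=> lm im; case: (DP (M k, k)) => _ _ /(_ l i lm im)[].
have M_homo : {homo M : k k' / (k <= k')%N}.
  apply: homo_leq => // [a b c|k]; first exact: leq_trans.
  by have /andP[/leq_trans h /ltnW /h] := gM k 0%N 0%N isT (n_gt0 k).
have g_inj k l i k' l' i' : (l < m'.+1)%N -> (i < n_ k)%N -> (l' < m'.+1)%N ->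
    (i' < n_ k')%N -> g k l i = g k' l' i' -> [/\ k = k', l = l' & i = i'].
  move=> lm im lm' im' e; have kk : k = k'.
    apply/eqP; rewrite eqn_leq; apply/andP; split; rewrite leqNgt; apply/negP => kk.
      have := gM _ _ _ lm im; have := gM _ _ _ lm' im'; have := M_homo _ _ kk; rewrite e; lia.
    have := gM _ _ _ lm im; have := gM _ _ _ lm' im'; have := M_homo _ _ kk; rewrite e; lia.
  subst k'; split=> //; case: (DP (M k, k)) => _ _ _ /(_ l i l' i' lm im lm' im' e)[] //.
have /choice[w_ wP] k : exists w : R[i], (n_ k).-primitive_root w.
  exact: prim_root_exists.
pose L := @hump_form R m' n_ w_ g.
have Lmul : multilinear L by exact: hump_form_multilinear.
have Lbd : bounded_form L by exact: hump_form_bounded.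
have [] := zmon (fun x => L (fun=> x)); first by exists L.
rewrite monomial_coefE//; set S := esum _ _ => Soo _.
have S_ge k : ((2 ^+ k)%:E <= S)%E.
  have [_ d0 dz _ h] := DP (M k, k).
  apply: (hump_sum_ge n_gt0 wP g_inj d0 _ h) => l i lm im.
  by case: (dz l i lm im).
have S0 : (0 <= S)%E by exact: le_trans (S_ge 0%N).
have Sfin : S \is a fin_num by rewrite ge0_fin_numE.
pose k := (Num.truncn (fine S)).+1.
have := S_ge k; rewrite -(fineK Sfin) lee_fin leNgt => /negP; apply.
apply: (@lt_le_trans _ _ k%:R); first exact: truncnS_gt.
by rewrite -natrX ler_nat ltnW// ltn_expl.
Qed.

Theorem theorem2p1 (R : realType) :
  (forall m : nat, (2 <= m)%N ->
     mon (R := R) m = weak_lq ((2 * m)%:R / (m.-1)%:R)) /\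
  (exists C : R, 0 < C /\
     forall (m : nat), (2 <= m)%N ->
     forall (z : linfty R), weak_lq ((2 * m)%:R / (m.-1)%:R) z ->
     forall (P : linfty R -> R[i]), hpoly m P ->
       (\esum_(a in [set a : multiindex | multideg a = m])
          (normc (monomial_coef P a * monomial z a))%:E
        <= (C ^+ m * fine (weak_norm ((2 * m)%:R / (m.-1)%:R) z) ^+ m
              * poly_norm P)%:E)%E).
Proof.
split=> [m m2|].
  apply/seteqP; split=> z; first exact: (mon_subset_weak_lq m2).
  move=> zq P [L [Lmul Lbd ->]]; rewrite monomial_coefE//.
  exact: abs_sums_to_form_coef.
(* The factors are 4 for shrinking radius 2 into the open unit ball, 2 for hypercontractivity and
   [2 * expR 1] for the sums with given last variable. *)
exists (16 * expR 1); split; first by rewrite mulr_gt0// expR_gt0.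
move=> m m2 z zq P [L [Lmul Lbd ->]]; rewrite monomial_coefE//.
by apply: esum_normc_le => r ur rm; exact: sum_form_coef_le.
Qed.
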